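(* Let $U\subseteq\mathbb{R}^m$ be a nonempty open set with Lebesgue measure $\mu$, and let $K$ be a bounded integral operator on the real Hilbert space $L^2(U)$ with measurable kernel $K(t,s)$, i.e. $Kf(t)=\int_U K(t,s)f(s)\,\mathrm{d}s$. Let $t_0\in U$ and suppose that the functions $$t\mapsto\mu(B(t_0,\epsilon))^{-1}\int_{B(t_0,\epsilon)}K(s,t)\,\mathrm{d}s$$ converge in $L^2(U)$ as $\epsilon\to0$. Then the associated Gaussian process $\tilde K$ is locally continuous in $t_0$.
   Context: $B(x,\epsilon)$ is the ball around $x$ of radius $\epsilon$ ($\epsilon$ small enough that it lies in $U$). For a bounded operator $O$ on $L^2(U)$, an orthonormal basis $(e_i)_{i\ge1}$ of $L^2(U)$ and i.i.d. $N(0,1)$ random variables $(X_i)_{i\ge1}$ on a probability space $(\Omega,\mathbb{F},P)$, the associated Gaussian process is $\tilde O(f)=\sum_{i=1}^\infty X_i\langle f,Oe_i\rangle$, $f\in L^2(U)$ (for each fixed $f$ the series converges almost surely). For a Borel set $A\subseteq U$ of finite measure, $\tilde O(A):=\tilde O(1_A)$. The process $\tilde O$ is called locally continuous in $x\in U$ if the random variables $\tilde O(B(x,\epsilon))/\mu(B(x,\epsilon))$ converge in $L^2(\Omega,P)$ as $\epsilon\to0$. The integrals of the kernel in the hypothesis are assumed to exist as Lebesgue integrals for almost every $t$. *)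

(* Defs.v *)
From HB Require Import structures.
From mathcomp Require Import all_boot all_order all_algebra finmap.
From mathcomp Require Import all_classical all_reals all_analysis.
From mathcomp Require Import measurable_realfun.
Set Implicit Arguments.
Unset Strict Implicit.
Unset Printing Implicit Defensive.
Import Order.TTheory GRing.Theory Num.Theory.
Import numFieldNormedType.Exports.
Local Open Scope classical_set_scope.
Local Open Scope ring_scope.

Definition rV_display : measure_display.
Proof. exact: default_measure_display. Qed.

HB.instance Definition _ (R : realType) (m : nat) :=
  @isMeasurable.Build rV_display 'rV[R]_m <<s @open 'rV[R]_m >>
    (@sigma_algebra0 _ setT _) (@sigma_algebraC _ _)
    (@sigma_algebra_bigcup _ setT _).

Lemma open_measurable_rV (R : realType) (m : nat) (U : set 'rV[R]_m) :
  open U -> measurable U.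
Proof. exact: sub_sigma_algebra. Qed.

Section lebesgue_tuple.
Context (R : realType).
Local Notation RT := (measurableTypeR R).
Local Open Scope ereal_scope.

Section cons.
Context (n : nat) (nu : {sigma_finite_measure set (n.-tuple RT) -> \bar R}).

Let cns (p : RT * n.-tuple RT) : n.+1.-tuple RT := [tuple of p.1 :: p.2].

Let mcns : measurable_fun [set: RT * n.-tuple RT] cns.
Proof. exact: measurable_cons. Qed.

Definition cons_measure : set (n.+1.-tuple RT) -> \bar R :=
  pushforward (@lebesgue_measure R \x nu) cns.

Let cons_measure0 : cons_measure set0 = 0.
Proof. by rewrite /cons_measure /pushforward preimage_set0 measure0. Qed.

Let cons_measure_ge0 A : 0 <= cons_measure A.
Proof. exact: measure_ge0. Qed.

Let cons_measure_sigma_additive : semi_sigma_additive cons_measure.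
Proof.
move=> F mF tF mUF; rewrite /cons_measure /pushforward preimage_bigcup.
apply: measure_semi_sigma_additive.
- by move=> i; rewrite -[X in measurable X]setTI; exact: mcns.
- apply/trivIsetP => /= i j _ _ ij; rewrite -preimage_setI.
  by move/trivIsetP : tF => /(_ _ _ _ _ ij) ->//; rewrite preimage_set0.
- by rewrite -preimage_bigcup -[X in measurable X]setTI; exact: mcns.
Qed.

HB.instance Definition _ := isMeasure.Build _ _ _ cons_measure
  cons_measure0 cons_measure_ge0 cons_measure_sigma_additive.

Let cons_measure_sigma_finite : sigma_finite setT cons_measure.
Proof.
have /sigma_finiteP[F [TF ndF mF]] := sigma_finiteT (@lebesgue_measure R).
have /sigma_finiteP[G [TG ndG mG]] := sigma_finiteT nu.
pose g (t : n.+1.-tuple RT) : RT * n.-tuple RT := (thead t, [tuple of behead t]).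
have mg : measurable_fun [set: n.+1.-tuple RT] g.
  apply/measurable_fun_pairP; split.
    exact: (measurable_tnth ord0).
  exact: measurable_behead.
have gK p : g (cns p) = p.
  by case: p => x t; congr pair => //; apply/val_inj.
exists (fun k => g @^-1` (F k `*` G k)).
  rewrite -preimage_bigcup -(preimage_setT g); congr (_ @^-1` _).
  apply/seteqP; split => // -[x t] _.
  have [i _ Fx] : (\bigcup_i F i) x by rewrite -TF.
  have [j _ Gt] : (\bigcup_i G i) t by rewrite -TG.
  exists (maxn i j) => //; split => /=.
    by move: x Fx; exact/subsetPset/ndF/leq_maxl.
  by move: t Gt; exact/subsetPset/ndG/leq_maxr.
move=> k; have [mFk Fk] := mF k; have [mGk Gk] := mG k; split.
  by rewrite -[X in measurable X]setTI; apply: mg => //; exact: measurableX.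
rewrite /cons_measure /pushforward (_ : _ @^-1` _ = F k `*` G k).
  by rewrite product_measure1E// lte_mul_pinfty// ge0_fin_numE.
by apply/funext => p; rewrite -[in RHS](gK p).
Qed.

HB.instance Definition _ := Measure_isSigmaFinite.Build _ _ _ cons_measure
  cons_measure_sigma_finite.

End cons.

Fixpoint lebesgue_tuple (n : nat) :
    {sigma_finite_measure set (n.-tuple RT) -> \bar R} :=
  match n with
  | 0 => \d_([tuple] : 0.-tuple RT)
  | n'.+1 => cons_measure (lebesgue_tuple n')
  end.

End lebesgue_tuple.

Section lebesgue_rV.
Context (R : realType) (m : nat).
Local Notation RT := (measurableTypeR R).

(* The library has Lebesgue measure on R only: on R^m it is built as an iterated
   product, and [lebesgue_rV_box] below characterizes it. *)
Definition rV_of_tuple (t : m.-tuple RT) : 'rV[R]_m := \row_i tnth t i.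

Lemma measurable_rV_of_tuple : measurable_fun setT rV_of_tuple.
Proof.
apply: (measurability (@open 'rV[R]_m)) => //.
move=> _ [A oA <-]; rewrite setTI.
pose B (qk : 'rV[rat]_m * nat) : set 'rV[R]_m :=
  ball (map_mx ratr qk.1 : 'rV[R]_m) qk.2.+1%:R^-1.
pose D := [set qk | B qk `<=` A].
have -> : A = \bigcup_qk (if qk \in D then B qk else set0).
  apply/seteqP; split => [x Ax|x [qk _]]; last first.
    by case: ifPn => // /[!inE] DA /DA.
  have /nbhs_ballP[e /= e0 xeA] : nbhs x A by exact: open_nbhs_nbhs.
  have e20 : 0 < e / 2 by rewrite divr_gt0.
  have [k _ /(_ _ (leqnn k)) /= ke] := near_infty_natSinv_lt (PosNum e20).
  have k0 : 0 < k.+1%:R^-1 :> R by rewrite invr_gt0.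
  have [q xq] : {q : 'I_m -> rat & forall i,
      ball (x ord0 i) k.+1%:R^-1 (ratr (q i) : R)}.
    apply: (@choice _ _ (fun i y => ball (x ord0 i) k.+1%:R^-1 (ratr y : R))).
    move=> i; have [r [xr [q _ qr]]] :=
      dense_rat (ex_intro _ (x ord0 i) (ballxx (x ord0 i) k0)) (ball_open (x ord0 i) _).
    by exists q; rewrite qr.
  have Bx : B (\row_i q i, k) x.
    by split => // i j; rewrite !mxE ord1; apply: ball_sym; exact: xq.
  exists (\row_i q i, k) => //; rewrite ifT// inE => y By.
  apply: xeA; rewrite (splitr e); apply: ball_triangle.
    by apply: le_ball (ball_sym Bx); exact: ltW.
  by apply: le_ball By; exact: ltW.
rewrite preimage_bigcup; apply: countable_bigcupT_measurable => // qk.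
case: ifPn => _; last by rewrite preimage_set0.
rewrite (_ : _ @^-1` _ = \bigcap_(i in [set: 'I_m])
    (@tnth m RT ^~ i @^-1` ball (ratr (qk.1 ord0 i) : R) qk.2.+1%:R^-1)).
  apply: fin_bigcap_measurable => // i _.
  rewrite -[X in measurable X]setTI; apply: measurable_tnth => //.
  by apply: (@open_measurable R); exact: ball_open.
apply/seteqP; split => [t [_ Bt] i _ | t Bt].
  by have := Bt ord0 i; rewrite !mxE.
by split => [|i j]; rewrite ?invr_gt0// !mxE ord1; exact: Bt.
Qed.

Definition lebesgue_rV : set 'rV[R]_m -> \bar R :=
  pushforward (lebesgue_tuple R m) rV_of_tuple.

Let lebesgue_rV0 : lebesgue_rV set0 = 0%E.
Proof. by rewrite /lebesgue_rV /pushforward preimage_set0 measure0. Qed.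

Let lebesgue_rV_ge0 A : (0 <= lebesgue_rV A)%E.
Proof. by rewrite /lebesgue_rV /pushforward measure_ge0. Qed.

Let lebesgue_rV_sigma_additive : semi_sigma_additive lebesgue_rV.
Proof.
move=> F mF tF mUF; rewrite /lebesgue_rV /pushforward preimage_bigcup.
apply: measure_semi_sigma_additive.
- by move=> i; rewrite -[X in measurable X]setTI; exact: measurable_rV_of_tuple.
- apply/trivIsetP => /= i j _ _ ij; rewrite -preimage_setI.
  by move/trivIsetP : tF => /(_ _ _ _ _ ij) ->//; rewrite preimage_set0.
- by rewrite -preimage_bigcup -[X in measurable X]setTI;
    exact: measurable_rV_of_tuple.
Qed.

HB.instance Definition _ := isMeasure.Build _ _ _ lebesgue_rV
  lebesgue_rV0 lebesgue_rV_ge0 lebesgue_rV_sigma_additive.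

Let lebesgue_rV_sigma_finite : sigma_finite setT lebesgue_rV.
Proof.
have [F TF mF] := sigma_finiteT (lebesgue_tuple R m).
pose g (v : 'rV[R]_m) : m.-tuple RT := [tuple v ord0 i | i < m].
have mg : measurable_fun [set: 'rV[R]_m] g.
  apply/measurable_fun_tnthP => i.
  rewrite (_ : _ \o _ = fun v : 'rV[R]_m => v ord0 i); last first.
    by apply/funext => v /=; rewrite tnth_mktuple.
  apply: (measurability _ (RGenOpens.measurableE R)).
  move=> _ [_ [a [b ->]] <-]; rewrite setTI; apply: open_measurable_rV.
  apply: open_comp => [v _|]; last exact: interval_open.
  exact: coord_continuous.
have gK t : g (rV_of_tuple t) = t.
  by apply: eq_from_tnth => i; rewrite tnth_mktuple mxE.
exists (fun k => g @^-1` F k).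
  by rewrite -preimage_bigcup -TF preimage_setT.
move=> k; have [mFk Fk] := mF k; split.
  by rewrite -[X in measurable X]setTI; exact: mg.
rewrite /lebesgue_rV /pushforward (_ : _ @^-1` _ = F k)//.
by apply/seteqP; split => t /=; rewrite gK.
Qed.

HB.instance Definition _ := Measure_isSigmaFinite.Build _ _ _ lebesgue_rV
  lebesgue_rV_sigma_finite.

End lebesgue_rV.

Lemma lebesgue_tuple_box (R : realType) (m : nat) (A : 'I_m -> set R) :
  (forall i, measurable (A i)) ->
  lebesgue_tuple R m [set t | forall i, A i (tnth t i)] =
  (\prod_(i < m) lebesgue_measure (A i))%E.
Proof.
elim: m A => [|m IH] A mA.
  rewrite big_ord0 /= (_ : [set _ | _] = setT) ?diracT//.
  by apply/seteqP; split => // t _ [].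
rewrite big_ord_recl -IH; last by move=> i; exact: mA.
rewrite -product_measure1E; [|exact: mA|]; last first.
  rewrite (_ : [set t | _] =
    \bigcap_(i in [set: 'I_m]) (@tnth m _ ^~ i @^-1` A (lift ord0 i))).
    apply: fin_bigcap_measurable => // i _.
    rewrite -[X in measurable X]setTI.
    by apply: (@measurable_tnth _ (measurableTypeR R) m i) => //; exact: mA.
  by apply/seteqP; split => t h i; [move=> _; exact: h|exact: (h i I)].
rewrite /= /cons_measure /pushforward; congr (product_measure1 _ _ _); apply/seteqP; split => -[x t] /=.
  move=> h; split => [|i]; first exact: (h ord0).
  by have := h (lift ord0 i); rewrite tnthS.
move=> [Ax At] i; case: (unliftP ord0 i) => [j|] -> //.
by rewrite tnthS; exact: At.
Qed.

Lemma lebesgue_rV_box (R : realType) (m : nat) (A : 'I_m -> set R) :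
  (forall i, measurable (A i)) ->
  lebesgue_rV [set v : 'rV[R]_m | forall i, A i (v ord0 i)] =
  (\prod_(i < m) lebesgue_measure (A i))%E.
Proof.
move=> mA; rewrite -lebesgue_tuple_box// /lebesgue_rV /pushforward.
by congr (lebesgue_tuple R m _); apply/seteqP; split => t h i;
  have := h i; rewrite mxE.
Qed.

(* The norm and the balls of the library on 'rV[R]_m are those of the sup norm
   (which has the same open sets). *)
Definition eball (R : realType) (m : nat) (x : 'rV[R]_m) (r : R) : set 'rV[R]_m :=
  [set y | Num.sqrt (\sum_(i < m) (y ord0 i - x ord0 i) ^+ 2) < r].

Section L2.
Context d (T : measurableType d) (R : realType).
Variable nu : {measure set T -> \bar R}.

(* Elements of L^2 are handled through representatives: identities between
   them are identities nu-almost everywhere. *)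
Definition L2 := LfunType nu (lee1n 2).

Definition L2dot (f g : T -> R) : R := (\int[nu]_x (f x * g x))%R.

Definition bounded_operator (O : L2 -> L2) : Prop :=
  (forall (a : R) (f g : L2),
     {ae nu, forall x, O (a *: f + g) x = a * O f x + O g x}) /\
  (exists C : R, forall f : L2,
     ('N[nu]_2%:E[EFin \o O f] <= C%:E * 'N[nu]_2%:E[EFin \o f])%E).

Definition orthonormal_basis (e : nat -> L2) : Prop :=
  (forall i j, L2dot (e i) (e j) = (i == j)%:R) /\
  (forall (f : L2) (eps : R), 0 < eps ->
     exists (n : nat) (c : nat -> R),
       ('N[nu]_2%:E[EFin \o (f - \sum_(i < n) c i *: e i)%R] < eps%:E)%E).

(* [f] is only required to be in L^2 eventually along [F]. *)
Definition converges_in_L2 (I : Type) (F : set_system I) (f : I -> T -> R) : Prop :=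
  (\forall i \near F, f i \in Lfun nu 2%:E) /\
  exists2 g : T -> R, g \in Lfun nu 2%:E &
    ('N[nu]_2%:E[EFin \o (f i \- g)%R])%E @[i --> F] --> 0%E.

End L2.

Section probability.
Context d (Omega : measurableType d) (R : realType) (P : probability Omega R).

Definition mutually_independent (X : nat -> {RV P >-> R}) : Prop :=
  forall (J : {fset nat}) (A : nat -> set R),
    (forall j, measurable (A j)) ->
    P (\bigcap_(j in [set` J]) (X j @^-1` A j)) =
    (\prod_(j <- J) P (X j @^-1` A j))%E.

Definition standard_normal (X : {RV P >-> R}) : Prop :=
  forall A : set R, measurable A -> distribution P X A = normal_prob 0 1 A.

Definition iid_standard_normal (X : nat -> {RV P >-> R}) : Prop :=
  mutually_independent X /\ forall i, standard_normal (X i).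

(* [limn] takes a default value at the points where the series diverges. *)
Definition gaussian_process d' (T : measurableType d')
    (nu : {measure set T -> \bar R}) (X : nat -> {RV P >-> R})
    (e : nat -> L2 nu) (O : L2 nu -> L2 nu) (f : T -> R) : Omega -> R :=
  fun w => limn (series (fun i => X i w * L2dot nu f (O (e i)))).

End probability.

Section open_subset.
Context (R : realType) (m : nat) (U : set 'rV[R]_m) (oU : open U).

(* A function on U is represented by a function on R^m whose values outside U
   are irrelevant; L2 (lebesgue_on oU) stands for L^2(U). *)
Definition lebesgue_on : {measure set 'rV[R]_m -> \bar R} :=
  mrestr (@lebesgue_rV R m) (open_measurable_rV oU).

Definition ball_mean (x : 'rV[R]_m) (r : R) (f : 'rV[R]_m -> R) : R :=
  (fine (lebesgue_rV (eball x r)))^-1 *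
  \int[@lebesgue_rV R m]_(s in eball x r) f s.

Definition integral_operator_with_kernel (K : 'rV[R]_m -> 'rV[R]_m -> R)
    (O : L2 lebesgue_on -> L2 lebesgue_on) : Prop :=
  measurable_fun (U `*` U) (fun ts => K ts.1 ts.2) /\
  forall f : L2 lebesgue_on, {ae lebesgue_on, forall t,
    (@lebesgue_rV R m).-integrable U (fun s => (K t s * f s)%:E) /\
    O f t = \int[@lebesgue_rV R m]_(s in U) (K t s * f s)}.

Definition locally_continuous d (Omega : measurableType d)
    (P : probability Omega R) (Y : ('rV[R]_m -> R) -> Omega -> R)
    (x : 'rV[R]_m) : Prop :=
  converges_in_L2 P 0^'+ (fun (eps : R) w =>
    Y \1_(eball x eps) w / fine (lebesgue_rV (eball x eps))).

End open_subset.

(* Main.v *)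
Require Import Defs.
From HB Require Import structures.
From mathcomp Require Import all_boot all_order all_algebra finmap.
From mathcomp Require Import all_classical all_reals all_analysis.
From mathcomp Require Import measurable_realfun ring lra.
Set Implicit Arguments.
Unset Strict Implicit.
Unset Printing Implicit Defensive.
Import Order.TTheory GRing.Theory Num.Theory.
Import numFieldNormedType.Exports.
Local Open Scope classical_set_scope.
Local Open Scope ring_scope.

(* Write mu for Lebesgue measure, B for the ball of radius eps around t0 and
   g_eps for the mean of K(s, .) over s in B. Then <1_B, K f> / mu(B) =
   <g_eps, f> for all f in L^2(U): when f lives on a set of finite measure on
   which the integral of |K(s, .)| over B is bounded this is Fubini's theorem,
   and such f are dense while both sides are continuous in f. Hence the process
   at B divided by mu(B) is the series sum_i X_i <g_eps, e_i>. By Kolmogorov's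
   maximal inequality a series sum_i X_i a_i with sum_i a_i^2 finite converges
   almost surely, and its second moment is at most E(X_0^2) sum_i a_i^2. With
   Bessel's inequality, the L^2(P) distance between the series of g_eps and of
   lim g_eps is at most a constant times the L^2(U) distance of the functions. *)

(** * Square-integrable functions *)

Section L2_square.
Context d (T : measurableType d) (R : realType).
Variable mu : {measure set T -> \bar R}.
Local Open Scope ereal_scope.
Implicit Types f g : T -> R.

Lemma integral_sqr_ge0 f : 0 <= \int[mu]_x (f x ^+ 2)%:E.
Proof. by apply: integral_ge0 => x _; rewrite lee_fin sqr_ge0. Qed.

Lemma Lnorm2E f :
  'N[mu]_2%:E[EFin \o f] = (\int[mu]_x (f x ^+ 2)%:E) `^ (2^-1).
Proof.
rewrite unlock; congr (_ `^ _); apply: eq_integral => x _ /=.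
by rewrite powR_mulrn// real_normK ?num_real.
Qed.

(** No integrability is assumed: when the integral is infinite, so is its square root, and both
    sides are [+oo]. *)
Lemma Lnorm2_sqr f :
  'N[mu]_2%:E[EFin \o f] * 'N[mu]_2%:E[EFin \o f] = \int[mu]_x (f x ^+ 2)%:E.
Proof.
rewrite Lnorm2E; have := integral_sqr_ge0 f.
case: (\int[mu]_x _) => [r| |]//; last by rewrite poweRyr ?invr_eq0// mulyy.
by rewrite lee_fin => r0; rewrite poweR_EFin -EFinM powR12_sqrt// -expr2 sqr_sqrtr.
Qed.

Lemma Lfun2P f : f \in Lfun mu 2%:E <->
  measurable_fun setT f /\ \int[mu]_x (f x ^+ 2)%:E < +oo.
Proof.
split=> [f2|[mf if2]].
  split; first by move: f2; rewrite inE => /andP[/[!inE]].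
  by have /(integrable_lty measurableT) := Lfun2_integrable_sqr f2.
rewrite inE; apply/andP; split; rewrite inE//= /finite_norm Lnorm2E.
exact: poweR_lty.
Qed.

Lemma Lfun2_measurable f : f \in Lfun mu 2%:E -> measurable_fun setT f.
Proof. by move=> /Lfun2P[]. Qed.

Lemma Lfun2_bounded_mul (h f : T -> R) : measurable_fun setT h ->
  (forall x, `|h x| <= 1)%R -> f \in Lfun mu 2%:E ->
  (fun x => h x * f x)%R \in Lfun mu 2%:E.
Proof.
move=> mh h1 /Lfun2P[mf if2]; apply/Lfun2P; split.
  exact: measurable_funM.
apply: le_lt_trans if2; apply: ge0_le_integral => //=.
- by move=> x _; rewrite lee_fin sqr_ge0.
- by apply/measurable_EFinP/measurable_funX/measurable_funM.
- by apply/measurable_EFinP/measurable_funX.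
- move=> x _; rewrite lee_fin exprMn ler_piMl ?sqr_ge0//.
  by rewrite -real_normK ?num_real// expr_le1.
Qed.

Lemma Lfun2D f g : f \in Lfun mu 2%:E -> g \in Lfun mu 2%:E ->
  (fun x => f x + g x)%R \in Lfun mu 2%:E.
Proof.
move=> f2 g2; have [_] := Lfun_addr_closed mu (lee1n 2).
by apply.
Qed.

Lemma Lfun2Z f a : f \in Lfun mu 2%:E -> (fun x => f x * a)%R \in Lfun mu 2%:E.
Proof. by apply: Lfun_scale; rewrite ler1n. Qed.

Lemma Lfun2B f g : f \in Lfun mu 2%:E -> g \in Lfun mu 2%:E ->
  (fun x => f x - g x)%R \in Lfun mu 2%:E.
Proof.
move=> f2 /(Lfun2Z (-1)) g2; have := Lfun2D f2 g2.
by under eq_fun do rewrite mulrN1.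
Qed.

Lemma Lfun2_integrableM f g : f \in Lfun mu 2%:E -> g \in Lfun mu 2%:E ->
  mu.-integrable setT (fun x => (f x * g x)%:E).
Proof. by move=> f2 g2; apply/Lfun1_integrable/Lfun2_mul_Lfun1. Qed.

Lemma Lfun2_integral_sqrD f g : f \in Lfun mu 2%:E -> g \in Lfun mu 2%:E ->
  \int[mu]_x ((f x + g x) ^+ 2)%:E =
  \int[mu]_x (f x ^+ 2)%:E + 2%:E * \int[mu]_x (f x * g x)%:E +
  \int[mu]_x (g x ^+ 2)%:E.
Proof.
move=> f2 g2.
have ifg := Lfun2_integrableM f2 g2.
have iff := Lfun2_integrable_sqr f2; have igg := Lfun2_integrable_sqr g2.
rewrite -integralZl// -integralD//; last exact: integrableZl.
rewrite -integralD//; last by apply: integrableD => //; exact: integrableZl.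
by apply: eq_integral => x _ /=; rewrite -!EFinM -!EFinD sqrrD mulr_natl.
Qed.

End L2_square.

(** * Independence of a variable from the past *)

Section independence.
Context d (Omega : measurableType d) (R : realType) (P : probability Omega R).
Local Open Scope ereal_scope.

(** The joint law of [Y] and [Z] agrees with the product of the two laws on rectangles, hence
    everywhere; the expectation of the product is then an iterated integral, by Fubini. *)
Lemma independent_integralM (Y Z : {RV P >-> R}) :
  (forall A B, measurable A -> measurable B ->
    P (Y @^-1` A `&` Z @^-1` B) = P (Y @^-1` A) * P (Z @^-1` B)) ->
  P.-integrable setT (EFin \o Y) -> P.-integrable setT (EFin \o Z) ->
  P.-integrable setT (fun w => (Y w * Z w)%:E) ->
  \int[P]_w (Y w * Z w)%:E = (\int[P]_w (Y w)%:E) * (\int[P]_w (Z w)%:E).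
Proof.
move=> indep iY iZ iYZ.
have mW : measurable_fun setT (fun w => (Y w, Z w)).
  exact: measurable_fun_pair.
pose W : {mfun Omega >-> (R * R)%type} :=
  HB.pack (fun w => (Y w, Z w)) (isMeasurableFun.Build _ _ _ _ _ mW).
have lawE A : measurable A ->
    (distribution P Y \x distribution P Z) A = pushforward P W A.
  by apply: product_measure_unique => B C mB mC; exact: indep.
have mm : measurable_fun [set: R * R]
    (fun xy => (xy.1 * xy.2)%:E).
  by apply/measurable_EFinP; exact: measurable_funM.
have -> : \int[P]_w (Y w * Z w)%:E =
    \int[pushforward P W]_xy (xy.1 * xy.2)%:E.
  by rewrite integral_pushforward.
rewrite (eq_measure_integral (distribution P Y \x distribution P Z)); last first.
  by move=> A mA _; exact/esym/lawE.
have iprod : (distribution P Y \x distribution P Z).-integrable setT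
    (fun xy => (xy.1 * xy.2)%:E).
  apply/integrableP; split => //.
  rewrite (eq_measure_integral (pushforward P W)); last first.
    by move=> A mA _; exact: lawE.
  rewrite ge0_integral_pushforward//; last exact: measurableT_comp.
  by case/integrableP : iYZ.
rewrite -integral12_prod_meas1//=.
have iZ' : (distribution P Z).-integrable setT (fun y => y%:E).
  apply: integrable_pushforward; [exact: measurable_funP|exact: EFin_measurable|exact: iZ|by []].
have iY' : (distribution P Y).-integrable setT (fun y => y%:E).
  apply: integrable_pushforward; [exact: measurable_funP|exact: EFin_measurable|exact: iY|by []].
rewrite (eq_integral (fun x : R => x%:E * \int[P]_w (Z w)%:E)); last first.
  move=> x _; rewrite /fubini_F /=.
  under eq_integral do rewrite EFinM.
  by rewrite integralZl// integral_distribution.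
rewrite -(fineK (integrable_fin_num measurableT iZ)).
by rewrite integralZr// integral_distribution.
Qed.

Variable X : nat -> {RV P >-> R}.

(** A pi-system generating the sigma-algebra of [X 0], ..., [X (n-1)]. Rectangles are closed under
    intersection, as the uniqueness theorem for measures requires of a generating family. *)
Definition past n : set_system Omega :=
  [set A | exists2 B : nat -> set R, (forall i, measurable (B i)) &
    A = \bigcap_(i in `I_n) X i @^-1` B i].

Lemma past_setI_closed n : setI_closed (past n).
Proof.
move=> _ _ [B mB ->] [C mC ->]; exists (fun i => B i `&` C i).
  by move=> i; exact: measurableI.
by rewrite -bigcapI.
Qed.

Lemma sub_past n k : (n <= k)%N -> past n `<=` past k.
Proof.
move=> nk _ [B mB ->]; exists (fun i => if (i < n)%N then B i else setT).
  by move=> i; case: ifP.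
apply/seteqP; split=> w /= h i /=.
  by move=> ik; case: ifPn => // inn; exact: h.
by move=> ni; have := h i; rewrite ni; apply; exact: leq_trans nk.
Qed.

Lemma past_preimage n i B : (i < n)%N -> measurable B -> past n (X i @^-1` B).
Proof.
move=> i_n mB; exists (fun j => if j == i then B else setT).
  by move=> j; case: ifP.
apply/seteqP; split=> w /=; first by move=> h j _ /=; case: eqP => // ->.
by move=> /(_ i i_n); rewrite /= eqxx.
Qed.

Lemma past_measurable n : past n `<=` measurable.
Proof.
move=> _ [B mB ->]; apply: fin_bigcap_measurable => [|i _]; first exact: finite_II.
by rewrite -[X in measurable X]setTI; exact: measurable_funP.
Qed.

Lemma sigma_past_measurable n : <<s past n>> `<=` measurable.
Proof.
apply: smallest_sub; first exact: sigma_algebra_measurable.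
exact: past_measurable.
Qed.

Hypothesis X_indep : mutually_independent X.

Lemma past_independent n A B : <<s past n>> A -> measurable B ->
  P (A `&` X n @^-1` B) = P A * P (X n @^-1` B).
Proof.
move=> sA mB.
have mXB : measurable (X n @^-1` B).
  by rewrite -[X in measurable X]setTI; exact: measurable_funP.
have prodP C k : (forall i, measurable (C i)) ->
    P (\bigcap_(i in `I_k) X i @^-1` C i) = \prod_(i < k) P (X i @^-1` C i).
  move=> mC; pose J : {fset nat} := seq_fset tt (iota 0 k).
  have := X_indep J mC.
  rewrite (_ : [set` J] = `I_k); last first.
    by apply/seteqP; split => i /=; rewrite seq_fsetE mem_iota.
  move=> ->; rewrite (perm_big (iota 0 k)).
    by rewrite -{1}[k]subn0 -/(index_iota 0 k) big_mkord.
  by rewrite -[X in perm_eq _ X](undup_id (iota_uniq 0 k)) seq_fset_perm.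
pose m1 := mrestr P mXB.
pose p := NngNum (fine_ge0 (measure_ge0 P (X n @^-1` B))).
pose m2 := mscale p P.
have m2E C : m2 C = P C * P (X n @^-1` B).
  by rewrite /m2 /mscale /= fineK ?fin_num_measure// muleC.
rewrite -m2E.
have sT : [set C | past n C /\ C `<=` setT] = past n.
  by apply/seteqP; split => C => [[]|].
apply: (g_sigma_algebra_measure_unique_trace (past n) setT _ _ _ m1 m2);
  rewrite ?sT//.
- exact: past_measurable.
- exact: past_setI_closed.
- apply: etrans (esym (m2E _)).
  by rewrite /= /mrestr setTI probability_setT mul1e.
- move=> _ [C mC ->]; apply: etrans (esym (m2E _)); rewrite /= /mrestr.
  (* Putting [B] at index [n] turns the intersection into a rectangle over [n.+1] indices, to which
     [prodP] applies. *)
  pose C' i := if (i < n)%N then C i else B.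
  have mC' i : measurable (C' i) by rewrite /C'; case: ifP.
  have -> : \bigcap_(i in `I_n) X i @^-1` C i `&` X n @^-1` B =
      \bigcap_(i in `I_n.+1) X i @^-1` C' i.
    rewrite /C'; apply/seteqP; split=> w /=.
      move=> [h1 h2] i; rewrite /= ltnS leq_eqVlt => /predU1P[->|i_n].
        by rewrite ltnn.
      by rewrite i_n; exact: h1.
    move=> h; split=> [i /= i_n|]; last by have := h n (ltnSn n); rewrite ltnn.
    by have := h i (ltnW i_n); rewrite i_n.
  rewrite !prodP// big_ord_recr/= {2}/C' ltnn; congr (_ * _).
  by apply: eq_bigr => i _; rewrite /C' ltn_ord.
- by rewrite /= /mrestr setTI (le_lt_trans (probability_le1 _ _))// ltry.
Qed.

Definition past_measurable_fun n (phi : Omega -> R) :=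
  measurable_fun (setT : set (g_sigma_algebraType (past n))) phi.

Lemma past_measurable_funW n phi : past_measurable_fun n phi ->
  measurable_fun setT phi.
Proof.
move=> mphi _ B mB; apply: (@sigma_past_measurable n).
exact: (mphi measurableT B mB).
Qed.

Lemma past_measurable_fun_le n k phi : (n <= k)%N ->
  past_measurable_fun n phi -> past_measurable_fun k phi.
Proof.
move=> nk mphi _ B mB.
have := mphi measurableT B mB; rewrite /measurable/=.
exact: sub_sigma_algebra2 (@sub_past _ _ nk) _.
Qed.

Lemma past_measurable_X n i : (i < n)%N -> past_measurable_fun n (X i).
Proof.
move=> i_n _ B mB; rewrite setTI; apply: sub_sigma_algebra.
exact: past_preimage.
Qed.

(** Independence from the past factors the expectation, and the factor coming from [X n] vanishes.
    This makes the cross terms disappear when a sum is squared. *)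
Lemma past_integral_eq0 n (phi : Omega -> R) : past_measurable_fun n phi ->
  phi \in Lfun P 2%:E -> (X n : Omega -> R) \in Lfun P 2%:E ->
  \int[P]_w (X n w)%:E = 0 ->
  \int[P]_w (phi w * X n w)%:E = 0.
Proof.
move=> mphi phi2 X2 X0.
have P1 : P setT \is a fin_num by rewrite fin_num_measure.
pose Y : {RV P >-> R} :=
  HB.pack phi (isMeasurableFun.Build _ _ _ _ _ (past_measurable_funW mphi)).
rewrite (@independent_integralM Y (X n)) ?X0 ?mule0//.
- move=> A B mA mB; apply: past_independent => //.
  by have := mphi measurableT A mA; rewrite setTI.
- by apply/Lfun1_integrable; exact: Lfun_subset12 phi2.
- by apply/Lfun1_integrable; exact: Lfun_subset12 X2.
- by have /Lfun1_integrable := Lfun2_mul_Lfun1 phi2 X2.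
Qed.

End independence.

(** * Kolmogorov's maximal inequality *)

Section random_series.
Context d (Omega : measurableType d) (R : realType) (P : probability Omega R).
Variables (X : nat -> {RV P >-> R}) (c : R).
Hypothesis X_indep : mutually_independent X.
Hypothesis X2 : forall i, (X i : Omega -> R) \in Lfun P 2%:E.
Hypothesis X_mean0 : forall i, (\int[P]_w (X i w)%:E = 0)%E.
Hypothesis X_sqr : forall i, (\int[P]_w (X i w ^+ 2)%:E <= c%:E)%E.

Local Notation past := (past X).
Local Notation past_measurable_fun := (past_measurable_fun X).

(** The martingale transform (discrete stochastic integral) of the series by the weights [H]; it is
    used with weights [H i] determined by the variables before [X i]. *)
Definition predictable_transform (H : nat -> Omega -> R) (a : nat -> R) n w : R :=
  \sum_(i < n) H i w * (X i w * a i).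

Lemma past_measurable_predictable_transform H a :
  (forall n, past_measurable_fun n (H n)) ->
  forall n, past_measurable_fun n (predictable_transform H a n).
Proof.
move=> mH n; apply: measurable_sum => i.
apply: measurable_funM.
  exact: past_measurable_fun_le (ltnW (ltn_ord i)) (mH i).
apply: measurable_funM => //; exact: past_measurable_X.
Qed.

(* The increments are orthogonal, each being independent of the past. *)
Lemma predictable_transform_sqr_le H a :
  (forall n, past_measurable_fun n (H n)) -> (forall n w, `|H n w| <= 1) ->
  forall n, predictable_transform H a n \in Lfun P 2%:E /\
    (\int[P]_w (predictable_transform H a n w ^+ 2)%:E <=
      (c * \sum_(i < n) a i ^+ 2)%:E)%E.
Proof.
move=> mH H1; elim=> [|n [T2 IH]].
  rewrite big_ord0 mulr0; have T0 w : predictable_transform H a 0 w = 0.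
    by rewrite /predictable_transform big_ord0.
  have I0 : (\int[P]_w (predictable_transform H a 0 w ^+ 2)%:E = 0)%E.
    by rewrite integral0_eq// => w _; rewrite T0 expr0n.
  split; last by rewrite I0.
  apply/Lfun2P; rewrite I0 ltry; split => //.
  by apply: past_measurable_funW; exact: past_measurable_predictable_transform.
have mHn := past_measurable_funW (mH n).
pose V w := X n w * (a n * H n w).
have V2 : V \in Lfun P 2%:E.
  have -> : V = fun w => H n w * (X n w * a n).
    by apply/funext => w; rewrite /V; ring.
  exact: (Lfun2_bounded_mul mHn (H1 n) (Lfun2Z (a n) (X2 n))).
have TV w : predictable_transform H a n.+1 w = predictable_transform H a n w + V w.
  by rewrite /predictable_transform big_ord_recr/= /V; congr (_ + _); ring.
have -> : predictable_transform H a n.+1 = fun w => predictable_transform H a n w + V w.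
  exact/funext.
split; first exact: (Lfun2D T2 V2).
rewrite Lfun2_integral_sqrD//.
have -> : (\int[P]_w (predictable_transform H a n w * V w)%:E = 0)%E.
  (* [phi] gathers every factor of the cross term except [X n]; it depends on the past only. *)
  pose phi w := H n w * predictable_transform H a n w * a n.
  transitivity (\int[P]_w (phi w * X n w)%:E)%E.
    by apply: eq_integral => w _; rewrite /phi /V; congr EFin; ring.
  apply: (past_integral_eq0 X_indep) => //.
    have mT := @past_measurable_predictable_transform H a mH n.
    exact: (measurable_funM (measurable_funM (mH n) mT) (measurable_cst _)).
  exact: (Lfun2Z (a n) (Lfun2_bounded_mul mHn (H1 n) T2)).
rewrite mule0 adde0 big_ord_recr/= mulrDr EFinD; apply: leeD => //.
(* As [H n] is at most 1 in absolute value, dropping it can only increase the second moment of the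
   new increment. *)
apply: (@le_trans _ _ (\int[P]_w ((a n ^+ 2)%:E * (X n w ^+ 2)%:E))%E).
  apply: ge0_le_integral => //=.
  - by move=> w _; rewrite lee_fin sqr_ge0.
  - by apply/measurable_EFinP/measurable_funX; exact: Lfun2_measurable V2.
  - apply/measurable_EFinP/measurable_funM => //; exact: measurable_funX.
  - move=> w _; rewrite lee_fin /V.
    have H2 : H n w ^+ 2 <= 1 by rewrite -real_normK ?num_real// expr_le1.
    have -> : (X n w * (a n * H n w)) ^+ 2 = a n ^+ 2 * X n w ^+ 2 * H n w ^+ 2.
      by ring.
    by rewrite ler_piMr// mulr_ge0// sqr_ge0.
rewrite ge0_integralZl//.
- by rewrite mulrC [leRHS]EFinM; apply: lee_wpmul2l; rewrite ?lee_fin ?sqr_ge0.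
- by apply/measurable_EFinP/measurable_funX.
- by move=> w _; rewrite lee_fin sqr_ge0.
- by rewrite lee_fin sqr_ge0.
Qed.

Definition partial_sum (a : nat -> R) n w : R := \sum_(i < n) X i w * a i.

Lemma past_measurable_partial_sum a n : past_measurable_fun n (partial_sum a n).
Proof.
apply: measurable_sum => i; apply: measurable_funM => //.
exact: past_measurable_X.
Qed.

Lemma measurable_partial_sum a n : measurable_fun setT (partial_sum a n).
Proof. exact: past_measurable_funW (@past_measurable_partial_sum a n). Qed.

Lemma partial_sum_sqr_le a n : partial_sum a n \in Lfun P 2%:E /\
  (\int[P]_w (partial_sum a n w ^+ 2)%:E <= (c * \sum_(i < n) a i ^+ 2)%:E)%E.
Proof.
have -> : partial_sum a n = predictable_transform (fun=> cst 1) a n.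
  by apply/funext => w; apply: eq_bigr => i _; rewrite mul1r.
apply: predictable_transform_sqr_le => [k|k w]; last by rewrite normr1.
exact: measurable_cst.
Qed.

(** The index [n] is included, yet the event is determined by [X 0], ..., [X (n-1)], so its
    indicator is an admissible weight for the increment containing [X n]. *)
Definition stays_below a l n : set Omega :=
  \bigcap_(k in `I_n.+1) [set w | `|partial_sum a k w| <= l].

(* The partial sums stopped when they first exceed [l] in absolute value form
   a predictable transform of the series. *)
Lemma kolmogorov_maximal a l n : 0 < l ->
  (P (~` stays_below a l n) <= (c / l ^+ 2 * \sum_(i < n) a i ^+ 2)%:E)%E.
Proof.
move=> l0; pose H k w : R := \1_(stays_below a l k) w.
have msb k : <<s past k>> (stays_below a l k).
  have mk :
      measurable (stays_below a l k : set (g_sigma_algebraType (past k))).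
    apply: fin_bigcap_measurable => [|i ik]; first exact: finite_II.
    rewrite -[X in measurable X]setTI.
    have /= mi : past_measurable_fun k (partial_sum a i).
      by apply: past_measurable_fun_le (@past_measurable_partial_sum a i).
    by have := measurableT_comp (@normr_measurable R setT) mi => /(_ measurableT _
      (measurable_itv `]-oo, l])); congr (measurable (_ `&` _));
      apply/seteqP; split => w; rewrite /= in_itv.
  exact: mk.
have mH k : past_measurable_fun k (H k).
  exact: (@measurable_indic _ (g_sigma_algebraType (past k)) R setT _ (msb k)).
have H1 k w : `|H k w| <= 1.
  by rewrite /H indicE; case: (_ \in _); rewrite ?normr1 ?normr0.
have [T2 Tle] := predictable_transform_sqr_le a mH H1 n.
have mT := Lfun2_measurable T2.
have sbS k w : stays_below a l k.+1 w -> stays_below a l k w.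
  by move=> h i /= ik; apply: h; exact: ltnW.
(* On this event the weights of the first [k.+1] increments are all 1, so the transform follows the
   partial sums up to and including the first exceedance. *)
have TE k w : stays_below a l k w -> predictable_transform H a k.+1 w = partial_sum a k.+1 w.
  move=> h; apply: eq_bigr => -[i/= ik] _.
  rewrite /H indicE mem_set ?mul1r// => j /= ji; apply: h => /=.
  exact: leq_trans ji ik.
(* There is no exceedance at index 0, where the sum is empty; once one has occurred, all later
   weights vanish and the transform keeps its value. *)
have stopped k w : ~ stays_below a l k w -> l < `|predictable_transform H a k w|.
  elim: k => [|k IH] h.
    exfalso; apply: h => i /=; rewrite ltnS leqn0 => /eqP ->.
    by rewrite /partial_sum big_ord0 normr0 ltW.
  have [sk|nsk] := pselect (stays_below a l k w).
    rewrite TE// ltNge; apply/negP => le_l; apply: h => i /=.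
    by rewrite ltnS leq_eqVlt => /predU1P[->|] //; exact: sk.
  rewrite /predictable_transform big_ord_recr/= {2}/H indicE memNset// mul0r addr0.
  exact: IH.
have mN : measurable (~` stays_below a l n).
  by apply: measurableC; exact: sigma_past_measurable (msb n).
have l20 : 0 < l ^+ 2 by rewrite exprn_gt0.
(* Chebyshev's inequality for the transform, whose square is at least [l ^+ 2] off
   [stays_below a l n]. *)
have : ((l ^+ 2)%:E * P (~` stays_below a l n) <=
    (c * \sum_(i < n) a i ^+ 2)%:E)%E.
  apply: le_trans Tle; rewrite -[X in P X]setIT -integral_indic//.
  rewrite -ge0_integralZl//=; last 2 first.
  - exact/measurable_EFinP/measurable_indic.
  - by rewrite lee_fin ltW.
  apply: ge0_le_integral => //=.
  - by move=> w _; rewrite -EFinM lee_fin mulr_ge0// ltW.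
  - by apply/measurable_EFinP/measurable_funM => //; exact: measurable_indic.
  - exact/measurable_EFinP/measurable_funX.
  - move=> w _; rewrite -EFinM lee_fin indicE.
    case: (boolP (w \in _)) => [/set_mem/stopped|_]; last by rewrite mulr0 sqr_ge0.
    rewrite mulr1 -[leRHS]real_normK ?num_real// => /ltW lT.
    by rewrite lerXn2r ?nnegrE ?(ltW l0).
rewrite mulrAC EFinM -lee_pdivlMl//.
by rewrite [X in (_ <= X)%E]muleC.
Qed.

End random_series.

(** * Almost sure convergence of series *)

Section cauchy_criterion.
Context (R : realType).

(** Only countably many tolerances and indices occur, so the set where a sequence of measurable
    functions converges is a countable combination of measurable sets. *)
Lemma cvgn_cauchyP (u : nat -> R) : cvgn u <->
  forall l, exists m, forall k, (m <= k)%N -> `|u k - u m| <= l.+1%:R^-1.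
Proof.
split=> [cu l|h].
  have l0 : 0 < l.+1%:R^-1 / 2 :> R by rewrite divr_gt0// invr_gt0.
  have /cvgrPdist_le/(_ _ l0)[m _ um] := cu.
  exists m => k mk; rewrite (splitr l.+1%:R^-1) -(subrKA (limn u)).
  rewrite (le_trans (ler_normD _ _))// lerD//; last exact: (um m (leqnn m)).
  by rewrite distrC; exact: (um k mk).
apply/cauchy_cvgP; apply: cauchy_exP => _/posnumP[e].
have [l _ /(_ _ (leqnn l)) le] := near_infty_natSinv_lt e.
have [m um] := h l; exists (u m); exists m => // k /= mk.
by rewrite /ball/= distrC (le_lt_trans (um _ mk)).
Qed.

Context d (T : measurableType d).

(** Convergence is not assumed: the set of convergence is measurable, and off it [limn] takes a
    constant default value. *)
Lemma measurable_fun_limn (f : nat -> T -> R) :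
  (forall n, measurable_fun setT (f n)) ->
  measurable_fun setT (fun x => limn (f ^~ x)).
Proof.
move=> mf; pose C := [set x | cvgn (f ^~ x)].
have mC : measurable C.
  have -> : C = \bigcap_l \bigcup_m \bigcap_(k in [set k | (m <= k)%N])
      [set x | `|f k x - f m x| <= l.+1%:R^-1].
    apply/seteqP; split => x /=.
      move=> /cvgn_cauchyP h l _; have [m hm] := h l.
      by exists m => // k /= mk; exact: hm.
    move=> h; apply/cvgn_cauchyP => l; have [m _ hm] := h l I.
    by exists m => k mk; exact: hm.
  apply: bigcapT_measurable => l; apply: bigcupT_measurable => m.
  apply: bigcap_measurable => [|k mk]; first by exists m => /=.
  rewrite -[X in measurable X]setTI.
  have mkm : measurable_fun setT (fun x => `|f k x - f m x|).
    by apply: measurableT_comp => //; exact: measurable_funB.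
  have := mkm measurableT _ (measurable_itv `]-oo, l.+1%:R^-1]).
  by congr (measurable (_ `&` _)); apply/seteqP; split=> x; rewrite /= in_itv.
rewrite -(setUv C); apply/measurable_funU => //; first exact: measurableC.
split.
  apply: (@measurable_fun_cvg _ _ _ _ f) => // n; exact: measurable_funTS.
apply: (eq_measurable_fun (cst point)); last exact: measurable_cst.
by move=> x; rewrite inE /= => ncvg; rewrite dvgP.
Qed.

End cauchy_criterion.

Section random_series_convergence.
Context d (Omega : measurableType d) (R : realType) (P : probability Omega R).
Variables (X : nat -> {RV P >-> R}) (c : R).
Hypothesis X_indep : mutually_independent X.
Hypothesis X2 : forall i, (X i : Omega -> R) \in Lfun P 2%:E.
Hypothesis X_mean0 : forall i, (\int[P]_w (X i w)%:E = 0)%E.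
Hypothesis X_sqr : forall i, (\int[P]_w (X i w ^+ 2)%:E <= c%:E)%E.

Local Notation partial_sum := (partial_sum X).
Local Notation stays_below := (stays_below X).

Lemma variance_bound_ge0 : 0 <= c.
Proof.
by rewrite -lee_fin (le_trans _ (X_sqr 0))// integral_sqr_ge0.
Qed.

(** [gaussian_process] unfolds to this, with coefficients [L2dot nu f (O (e i))]. *)
Definition random_series (a : nat -> R) w : R :=
  limn (series (fun i => X i w * a i)).

Lemma random_seriesE a w : series (fun i => X i w * a i) = partial_sum a ^~ w.
Proof. by apply/funext => n; rewrite seriesEord. Qed.

Lemma measurable_stays_below a l n : measurable (stays_below a l n).
Proof.
apply: fin_bigcap_measurable => [|i _]; first exact: finite_II.
rewrite -[X in measurable X]setTI.
have := measurableT_comp (@normr_measurable R setT) (measurable_partial_sum X a i).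
move=> /(_ measurableT _ (measurable_itv `]-oo, l])).
by congr (measurable (_ `&` _)); apply/seteqP; split => w; rewrite /= in_itv.
Qed.

(** Zeroing the first [m] coefficients turns the increments of the partial sums after [m] into
    partial sums over the same [X], so the maximal inequality applies to them without reindexing. *)
Let tail a m j : R := if (m <= j)%N then a j else 0.

Lemma partial_sum_tail a m k w : (m <= k)%N ->
  partial_sum (tail a m) k w = partial_sum a k w - partial_sum a m w.
Proof.
move=> mk; rewrite /partial_sum -(big_mkord xpredT (fun i => X i w * tail a m i)).
rewrite -!(big_mkord xpredT (fun i => X i w * a i)) (big_cat_nat _ mk)//=.
rewrite [Y in _ = Y - _](big_cat_nat _ mk)//= addrAC subrr add0r.
rewrite big_nat big1 ?add0r; last first.
  by move=> i /andP[_ im]; rewrite /tail leqNgt im mulr0.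
by apply: eq_big_nat => i /andP[mi _]; rewrite /tail mi.
Qed.

Lemma sum_tail_sqr_le (a : nat -> R) m n : cvgn (series (fun i => a i ^+ 2)) ->
  \sum_(i < n) tail a m i ^+ 2 <=
    limn (series (fun i => a i ^+ 2)) - series (fun i => a i ^+ 2) m.
Proof.
move=> ca; pose s := series (fun i => a i ^+ 2).
have nds : nondecreasing_seq s.
  by apply: nondecreasing_series => i _ _; exact: sqr_ge0.
(* The index [maxn m n] treats [n <= m] and [m < n] at once. *)
rewrite lerBrDr; apply: le_trans (nondecreasing_cvgn_le nds ca (maxn m n)).
rewrite /s /series/= (big_cat_nat (leq0n m) (leq_maxl m n))//= [leLHS]addrC lerD2l.
rewrite -(big_mkord xpredT (fun i => tail a m i ^+ 2)).
apply: (@le_trans _ _ (\sum_(0 <= i < maxn m n) tail a m i ^+ 2)).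
  rewrite (big_cat_nat (leq0n n) (leq_maxr m n))//= lerDl.
  by apply: sumr_ge0 => i _; exact: sqr_ge0.
rewrite (big_cat_nat (leq0n m) (leq_maxl m n))//= big_nat big1 ?add0r; last first.
  by move=> i /andP[_ im]; rewrite /tail leqNgt im expr0n.
by apply: ler_sum_nat => i /andP[mi _]; rewrite /tail mi.
Qed.

(** Kolmogorov's convergence theorem. The maximal inequality for the tails bounds the probability
    that the partial sums ever move away from the one at [m] by more than a given tolerance; the
    bound is a multiple of the remainder of the series of squares, which tends to 0. *)
Lemma ae_cvg_random_series (a : nat -> R) : cvgn (series (fun i => a i ^+ 2)) ->
  {ae P, forall w, cvgn (series (fun i => X i w * a i))}.
Proof.
move=> ca; pose s := series (fun i => a i ^+ 2).
pose F l m n := ~` stays_below (tail a m) l.+1%:R^-1 n.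
have mF l m n : measurable (F l m n).
  by apply: measurableC; exact: measurable_stays_below.
(* Where the series diverges, some tolerance is violated after every index [m]. *)
pose N := \bigcup_l \bigcap_m \bigcup_n F l m n.
apply: (@negligibleS _ _ _ _ N).
  move=> w /= ncvg; apply: contrapT => Nw; apply: ncvg.
  rewrite random_seriesE; apply/cvgn_cauchyP => l.
  have : ~ (\bigcap_m \bigcup_n F l m n) w by move=> h; apply: Nw; exists l.
  move=> /existsNP[m /not_implyP[_ Fw]]; exists m => k mk.
  have : stays_below (tail a m) l.+1%:R^-1 k w.
    by apply: contrapT => h; apply: Fw; exists k.
  by move=> /(_ k (ltnSn k)) /=; rewrite partial_sum_tail.
apply: negligible_bigcup => l; set B := \bigcap_m _.
have mFm m : measurable (\bigcup_n F l m n) by exact: bigcupT_measurable.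
have mB : measurable B by exact: bigcapT_measurable.
apply/negligibleP => //; apply/eqP; rewrite eq_le measure_ge0 andbT.
pose C := c / l.+1%:R^-1 ^+ 2.
have Ble m : (P B <= (C * (limn s - s m))%:E)%E.
  apply: (@le_trans _ _ (P (\bigcup_n F l m n))).
    by apply: le_measure; rewrite ?inE//; exact: bigcap_inf.
  (* The events grow with [n], so the probability of their union is a limit of probabilities that
     the maximal inequality bounds uniformly. *)
  have ndF : {homo F l m : n k / (n <= k)%N >-> (n <= k)%O}.
    move=> n k nk; apply/subsetPset => w; apply: contra_not => h i /= ik.
    by apply: h; exact: leq_trans ik _.
  have cF := nondecreasing_cvg_mu (mu := P) (mF l m) (mFm m) ndF.
  rewrite -(cvg_lim _ cF)//; apply: lime_le.
    by apply/cvg_ex; eexists; exact: cF.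
  apply: nearW => n /=; apply: le_trans.
    by apply: (kolmogorov_maximal X_indep X2 X_mean0 X_sqr); rewrite invr_gt0.
  rewrite lee_fin; apply: ler_wpM2l (sum_tail_sqr_le _ _ ca).
  by rewrite divr_ge0 ?variance_bound_ge0// exprn_ge0// invr_ge0.
have C0 : (C * (limn s - s m))%:E @[m --> \oo] --> 0%E.
  apply: cvg_EFin; first exact: nearW.
  rewrite -[X in _ --> X](mulr0 C) -(subrr (limn s)).
  by apply: cvgMr; apply: cvgB; [exact: cvg_cst|exact: ca].
rewrite -(cvg_lim _ C0)//; apply: lime_ge; last exact: nearW.
by apply/cvg_ex; eexists; exact: C0.
Qed.

Lemma measurable_random_series a : measurable_fun setT (random_series a).
Proof.
rewrite /random_series; under eq_fun do rewrite random_seriesE.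
by apply: measurable_fun_limn => n; exact: measurable_partial_sum.
Qed.

(** Fatou's lemma: almost surely the squared partial sums converge to the square of the series, and
    [partial_sum_sqr_le] bounds their expectations uniformly. *)
Lemma random_series_sqr_le (a : nat -> R) : cvgn (series (fun i => a i ^+ 2)) ->
  (\int[P]_w (random_series a w ^+ 2)%:E <=
     (c * limn (series (fun i => a i ^+ 2)))%:E)%E.
Proof.
move=> ca; pose S n w := (partial_sum a n w ^+ 2)%:E.
have mS n : measurable_fun setT (S n).
  by apply/measurable_EFinP/measurable_funX; exact: measurable_partial_sum.
have S0 n w : (0 <= S n w)%E by rewrite lee_fin sqr_ge0.
have S_le n : (\int[P]_w S n w <= (c * limn (series (fun i => a i ^+ 2)))%:E)%E.
  have [_ /le_trans] := partial_sum_sqr_le X_indep X2 X_mean0 X_sqr a n.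
  apply; rewrite lee_fin ler_wpM2l ?variance_bound_ge0//.
  rewrite -(big_mkord xpredT (fun i => a i ^+ 2)).
  apply: nondecreasing_cvgn_le ca n; apply: nondecreasing_series => i _ _.
  exact: sqr_ge0.
have einf0 (u : nat -> \bar R) : (forall n, 0 <= u n)%E -> (0 <= limn_einf u)%E.
  move=> u0; rewrite limn_einf_lim; apply: lime_ge; first exact: is_cvg_einfs.
  by apply: nearW => n; apply: le_ereal_inf_tmp => _ [k _ <-]; exact: u0.
apply: (@le_trans _ _ (\int[P]_w limn_einf (S ^~ w))%E).
  apply: ae_ge0_le_integral => //.
  - by move=> w _; rewrite lee_fin sqr_ge0.
  - by apply/measurable_EFinP/measurable_funX; exact: measurable_random_series.
  - by move=> w _; exact: einf0.
  - apply: measurableT_comp => //; apply: measurable_fun_limn_esup => n.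
    exact: measurableT_comp (mS n).
  apply: filterS (ae_cvg_random_series ca) => w + _.
  rewrite /random_series random_seriesE => cw.
  have Sw : S ^~ w @ \oo --> (limn (partial_sum a ^~ w) ^+ 2)%:E.
    by apply: cvg_EFin; [exact: nearW|apply: cvgM; exact: cw].
  by rewrite (cvg_limn_einf_sup Sw).1.
apply: le_trans (fatou _ _ _ _) _ => //.
rewrite limn_einf_lim; apply: lime_le; first exact: is_cvg_einfs.
apply: nearW => n; apply: le_trans (S_le n).
by apply: ereal_inf_lbound; exists n => //=.
Qed.

(** Limits subtract where both series converge; elsewhere [limn] may be a default value, hence the
    exceptional null set. *)
Lemma ae_random_seriesB (a b : nat -> R) : cvgn (series (fun i => a i ^+ 2)) ->
  cvgn (series (fun i => b i ^+ 2)) ->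
  {ae P, forall w, random_series (fun i => a i - b i) w =
    random_series a w - random_series b w}.
Proof.
move=> /ae_cvg_random_series ca /ae_cvg_random_series cb.
apply: filterS2 ca cb => w ca cb; rewrite /random_series -limB//.
congr (limn _); apply/funext => n.
transitivity (series (fun i => X i w * a i) n - series (fun i => X i w * b i) n);
  last by [].
rewrite /series/= -sumrB.
by apply: eq_bigr => i _; rewrite mulrBr.
Qed.

(** Square summability is assumed for the scaled coefficients only. If [k] is 0, both sides vanish
    whatever the value of the series of [a]; otherwise division by [k] recovers that series from the
    scaled one. *)
Lemma ae_random_seriesZ k (a : nat -> R) :
  cvgn (series (fun i => (a i * k) ^+ 2)) ->
  {ae P, forall w, random_series a w * k = random_series (fun i => a i * k) w}.
Proof.
have [->|k0] := eqVneq k 0.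
  move=> _; apply: nearW => w; rewrite mulr0 /random_series.
  apply/esym/cvg_lim => //; apply: cvg_near_cst; apply: nearW => n.
  by rewrite /series/= big1// => i _; rewrite !mulr0.
move=> /ae_cvg_random_series; apply: filterS => w ca.
rewrite /random_series; set s := series (fun i => X i w * (a i * k)) in ca *.
rewrite (_ : series _ = fun n => s n * k^-1).
  have cs : s n * k^-1 @[n --> \oo] --> limn s * k^-1 by apply: cvgMl; exact: ca.
  by rewrite (cvg_lim _ cs)// mulfVK.
apply/funext => n; rewrite /s /series/= mulr_suml.
by apply: eq_bigr => i _; rewrite mulrA mulfK.
Qed.

End random_series_convergence.

(** * Moments of the normal distribution *)

Section normal_moments.
Context (R : realType).
Local Notation mu := (@lebesgue_measure R).
Local Notation normal := (@normal_prob R 0 1).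
Local Open Scope ereal_scope.

(** The Radon-Nikodym derivative of the normal law agrees almost everywhere with the density, since
    both have the same integral over every measurable set. *)
Lemma ge0_integral_normal (f : R -> \bar R) : (forall x, 0 <= f x) ->
  measurable_fun setT f ->
  \int[normal]_x f x = \int[mu]_x (f x * (normal_pdf 0 1 x)%:E).
Proof.
move=> f0 mf; have dom := @normal_prob_dominates R 0 1.
pose g := Radon_Nikodym_SigmaFinite.f normal mu.
have ig : mu.-integrable setT g := Radon_Nikodym_SigmaFinite.f_integrable dom.
have g0 := Radon_Nikodym_SigmaFinite.f_ge0 dom.
have mg : measurable_fun setT g := measurable_int _ ig.
have mpdf := @measurable_normal_pdf R 0 1.
rewrite -(Radon_Nikodym_SigmaFinite.change_of_variables dom)//.
apply: ge0_ae_eq_integral => //.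
- exact: emeasurable_funM.
- by apply: emeasurable_funM => //; exact/measurable_EFinP.
- by move=> x _; rewrite mule_ge0.
- by move=> x _; rewrite mule_ge0// lee_fin normal_pdf_ge0.
apply: ae_eqe_mul2l; apply: integral_ae_eq => //.
- exact/measurable_EFinP.
- by move=> A _ mA; rewrite -(Radon_Nikodym_SigmaFinite.f_integral dom).
Qed.

(** The integrand is dominated by a multiple of the normal density of standard deviation 2. *)
Lemma normal_sqr_lty : \int[normal]_x (x ^+ 2)%:E < +oo.
Proof.
have msqr : measurable_fun setT (fun x : R => (x ^+ 2)%:E).
  exact/measurable_EFinP/measurable_funX.
rewrite ge0_integral_normal//; last by move=> x; rewrite lee_fin sqr_ge0.
have p2 : (0 < normal_peak (2 : R))%R by rewrite normal_peak_gt0.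
(* With y = 3 x^2 / 8, the bound 1 + y <= exp y gives x^2 <= (8 / 3) exp y, and multiplying by exp y
   turns exp(- x^2 / 2) into exp(- x^2 / 8). The quotient of the peaks adjusts the normalization. *)
pose K : R := (normal_peak 1 * (8 / 3) / normal_peak 2)%R.
have K0 : (0 <= K)%R by rewrite !mulr_ge0 ?invr_ge0 ?normal_peak_ge0.
apply: (@le_lt_trans _ _ (\int[mu]_x (K%:E * (normal_pdf 0 2 x)%:E))).
  apply: ge0_le_integral => //=.
  - by move=> x _; rewrite lee_fin mulr_ge0 ?sqr_ge0 ?normal_pdf_ge0.
  - apply/measurable_EFinP/measurable_funM; first exact: measurable_funX.
    exact: measurable_normal_pdf.
  - apply/measurable_EFinP/measurable_funM => //.
    exact: measurable_normal_pdf.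
  - move=> x _; rewrite lee_fin !normal_pdfE// /K.
    have -> : (normal_peak 1 * (8 / 3) / normal_peak 2 *
        (normal_peak 2 * normal_fun 0 2 x) =
        normal_peak 1 * (8 / 3 * normal_fun 0 2 x))%R.
      by field; rewrite gt_eqF.
    rewrite mulrCA ler_wpM2l ?normal_peak_ge0// /normal_fun subr0.
    pose y : R := (3 / 8 * x ^+ 2)%R.
    have -> : (- x ^+ 2 / (2 ^+ 2 *+ 2) = - x ^+ 2 / (1 ^+ 2 *+ 2) + y)%R.
      by rewrite /y; field.
    rewrite expRD mulrCA mulrC ler_wpM2l ?expR_ge0//.
    have := expR_ge1Dx y; rewrite /y => ?; lra.
rewrite integralZl//; last exact: integrable_normal_pdf.
by rewrite integral_normal_pdf mule1 ltry.
Qed.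

(** The density is even and Lebesgue measure is invariant under negation. *)
Lemma ge0_integral_normalN (f : R -> \bar R) : (forall x, 0 <= f x) ->
  measurable_fun setT f ->
  \int[normal]_x f (- x)%R = \int[normal]_x f x.
Proof.
move=> f0 mf.
have mfN : measurable_fun setT (fun x : R => f (- x)%R) by exact: measurableT_comp.
have mpdf := @measurable_normal_pdf R 0 1.
rewrite !ge0_integral_normal//.
pose g x := f x * (normal_pdf 0 1 x)%:E.
have mg : measurable_fun setT g.
  by apply: emeasurable_funM => //; exact/measurable_EFinP.
have g0 x : 0 <= g x by rewrite mule_ge0// lee_fin normal_pdf_ge0.
transitivity (\int[mu]_x g (- x)%R).
  apply: eq_integral => x _; rewrite /g !normal_pdfE// /normal_fun.
  by rewrite !subr0 sqrrN.
rewrite -/g [RHS](eq_measure_integral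
  (pushforward mu (-%R : _ -> measurableTypeR R))).
  by rewrite ge0_integral_pushforward// => x _; exact: g0.
by move=> A mA _; exact/esym/lebesgue_measureN.
Qed.

Context d (Omega : measurableType d) (P : probability Omega R).
Variable X : {RV P >-> R}.
Hypothesis X_normal : standard_normal X.

Lemma ge0_integral_standard_normal (f : R -> \bar R) : (forall x, 0 <= f x) ->
  measurable_fun setT f -> \int[P]_w f (X w) = \int[normal]_x f x.
Proof.
move=> f0 mf.
have mX : measurable_fun setT (X : Omega -> measurableTypeR R).
  by move=> _ B mB; have := measurable_funP X; apply.
rewrite -(@ge0_integral_pushforward _ _ _ _ _ _ mX P setT f)//.
by apply: eq_measure_integral => A mA _; exact: X_normal.
Qed.

Lemma standard_normal_sqr :
  \int[P]_w (X w ^+ 2)%:E = \int[normal]_x (x ^+ 2)%:E.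
Proof.
rewrite -ge0_integral_standard_normal//; last exact/measurable_EFinP/measurable_funX.
by move=> x; rewrite lee_fin sqr_ge0.
Qed.

Lemma standard_normal_Lfun2 : (X : Omega -> R) \in Lfun P 2%:E.
Proof. by apply/Lfun2P; rewrite standard_normal_sqr normal_sqr_lty. Qed.

(** By symmetry the positive and negative parts have the same integral, which is finite because [X]
    is integrable. *)
Lemma standard_normal_mean0 : \int[P]_w (X w)%:E = 0.
Proof.
have X1 : P.-integrable setT (EFin \o X).
  apply/Lfun1_integrable; apply: Lfun_subset12 standard_normal_Lfun2.
  by rewrite fin_num_measure.
pose p (x : R) : \bar R := maxe x%:E 0.
have mp : measurable_fun setT p by apply: measurable_maxe.
have p0 x : 0 <= p x by rewrite /p le_max lexx orbT.
have mpN : measurable_fun setT (fun x : R => p (- x)%R) by exact: measurableT_comp.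
rewrite integralE.
have -> : \int[P]_w (EFin \o X)^\- w = \int[P]_w p (- X w)%R.
  by apply: eq_integral => w _; rewrite funenegE.
have pE : \int[P]_w (EFin \o X)^\+ w = \int[P]_w p (X w).
  by apply: eq_integral => w _; rewrite funeposE.
rewrite pE (@ge0_integral_standard_normal (fun x => p (- x)%R))//.
rewrite ge0_integral_standard_normal// ge0_integral_normalN// subee//.
rewrite -ge0_integral_standard_normal//.
by rewrite -pE ge0_fin_numE ?integral_funepos_lt_pinfty// integral_ge0.
Qed.

End normal_moments.

(** * Bessel's inequality *)

Section L2dot.
Context d (T : measurableType d) (R : realType).
Variable nu : {measure set T -> \bar R}.
Implicit Types f g h : T -> R.
Local Notation dot := (L2dot nu).

Lemma EFin_L2dot f g : f \in Lfun nu 2%:E -> g \in Lfun nu 2%:E ->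
  (dot f g)%:E = (\int[nu]_x (f x * g x)%:E)%E.
Proof.
by move=> f2 g2; rewrite fineK// (integrable_fin_num measurableT)// Lfun2_integrableM.
Qed.

Lemma L2dotC f g : dot f g = dot g f.
Proof. by congr fine; apply: eq_integral => x _; rewrite mulrC. Qed.

Lemma L2dotBr f g h : f \in Lfun nu 2%:E -> g \in Lfun nu 2%:E ->
  h \in Lfun nu 2%:E -> dot f (fun x => g x - h x) = dot f g - dot f h.
Proof.
move=> f2 g2 h2; rewrite /L2dot -RintegralB//; last 2 first.
- exact: Lfun2_integrableM.
- exact: Lfun2_integrableM.
by apply: eq_Rintegral => x _; rewrite mulrBr.
Qed.

Lemma L2dotZr f g a : f \in Lfun nu 2%:E -> g \in Lfun nu 2%:E ->
  dot f (fun x => g x * a) = dot f g * a.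
Proof.
move=> f2 g2; rewrite /L2dot -RintegralZr//; last exact: Lfun2_integrableM.
by apply: eq_Rintegral => x _; rewrite mulrA.
Qed.

Lemma L2dot_ae_eq f g h : f \in Lfun nu 2%:E -> g \in Lfun nu 2%:E ->
  h \in Lfun nu 2%:E -> {ae nu, forall x, g x = h x} -> dot f g = dot f h.
Proof.
move=> f2 g2 h2 gh; congr fine; apply: ae_eq_integral => //.
- exact: measurable_int (Lfun2_integrableM f2 g2).
- exact: measurable_int (Lfun2_integrableM f2 h2).
- by apply: filterS gh => x + _ => ->.
Qed.

Lemma L2dot_CauchySchwarz f g : f \in Lfun nu 2%:E -> g \in Lfun nu 2%:E ->
  (`|dot f g|%:E <= 'N[nu]_2%:E[EFin \o f] * 'N[nu]_2%:E[EFin \o g])%E.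
Proof.
move=> f2 g2.
have := @hoelder _ _ _ nu f g 2 2 (Lfun2_measurable f2) (Lfun2_measurable g2).
move=> /(_ _ _ _)/(le_trans _); apply => //; last by rewrite [RHS]splitr !div1r.
rewrite -abse_EFin EFin_L2dot// Lnorm1; apply: le_abse_integral => //.
exact: measurable_int (Lfun2_integrableM f2 g2).
Qed.

(** The residual is [g] minus its projection on the first [n] vectors, built one vector at a time:
    removing the component along [e n] leaves the later coefficients unchanged and splits off its
    square by Pythagoras. *)
Lemma Bessel_residual (e : nat -> L2 nu) g : g \in Lfun nu 2%:E ->
  (forall i j, dot (e i) (e j) = (i == j)%:R) ->
  forall n, exists r : T -> R, [/\ r \in Lfun nu 2%:E,
    forall j, (n <= j)%N -> dot r (e j) = dot g (e j) &
    \sum_(i < n) dot g (e i) ^+ 2 + dot r r = dot g g].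
Proof.
move=> g2 oe; elim=> [|n [r [r2 re rr]]].
  by exists g; split => //; rewrite big_ord0 add0r.
have e2 i : (e i : T -> R) \in Lfun nu 2%:E by exact: LfunP.
pose c := dot g (e n).
have s2 : (fun x => e n x * c) \in Lfun nu 2%:E by exact: Lfun2Z.
exists (fun x => r x - e n x * c); split; first exact: (Lfun2B r2 s2).
  move=> j nj; rewrite L2dotC L2dotBr// L2dotZr// oe gtn_eqF// mul0r subr0.
  by rewrite L2dotC re// ltnW.
have t2 := Lfun2B r2 s2.
have rs : dot r (fun x => e n x * c) = c * c by rewrite L2dotZr// re.
have ss : dot (fun x => e n x * c) (fun x => e n x * c) = c * c.
  by rewrite L2dotZr// L2dotC L2dotZr// oe eqxx mul1r.
rewrite L2dotBr// ![dot (fun x => r x - _) _]L2dotC !L2dotBr// ss.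
rewrite [dot (fun x => e n x * c) r]L2dotC rs -rr big_ord_recr/= -/c.
by ring.
Qed.

(** The squared norm of the residual is nonnegative, so the increasing partial sums are bounded by
    [dot g g]. *)
Lemma Bessel (e : nat -> L2 nu) g : g \in Lfun nu 2%:E ->
  (forall i j, dot (e i) (e j) = (i == j)%:R) ->
  cvgn (series (fun i => dot g (e i) ^+ 2)) /\
  ((limn (series (fun i => dot g (e i) ^+ 2)))%:E <=
    \int[nu]_x (g x ^+ 2)%:E)%E.
Proof.
move=> g2 oe; pose s := series (fun i => dot g (e i) ^+ 2).
have s_le n : s n <= dot g g.
  have [r [_ _ <-]] := Bessel_residual g2 oe n.
  by rewrite /s seriesEord lerDl fine_ge0// integral_sqr_ge0.
have cs : cvgn s.
  apply: nondecreasing_is_cvgn; last by exists (dot g g) => _ [n _ <-].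
  by apply: nondecreasing_series => i _ _; exact: sqr_ge0.
split => //; rewrite -[leRHS]EFin_L2dot// lee_fin; apply: limr_le => //.
exact: nearW.
Qed.

End L2dot.

(** * The adjoint of an integral operator at an indicator function *)

Section restricted_measure.
Context d (T : measurableType d) (R : realType).
Variables (mu : {measure set T -> \bar R}) (U : set T) (mU : measurable U).
Local Notation nu := (mrestr mu mU).

Lemma ae_mrestr (Q : T -> Prop) :
  {ae nu, forall x, Q x} -> {ae mu, forall x, U x -> Q x}.
Proof.
move=> [A [mA A0 QA]]; exists (A `&` U); split => //; first exact: measurableI.
move=> x /= /not_implyP[Ux nQx]; split => //; exact: QA.
Qed.

(** The complement of [U] is null for the restricted measure, so the values of [f] there do not
    count. *)
Lemma integral_mrestr (f : T -> \bar R) : measurable_fun setT f ->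
  (\int[nu]_x f x = \int[mu]_(x in U) f x)%E.
Proof.
move=> mf; have mfU : measurable_fun setT (f \_ U).
  by apply/(measurable_restrictT f) => //; exact: measurable_funTS.
transitivity (\int[nu]_(x in U) f x)%E; last first.
  by apply: eq_measure_integral => A mA AU; rewrite /= /mrestr setIidl.
rewrite [RHS]integral_mkcond; apply: ae_eq_integral => //.
exists (~` U); split; first exact: measurableC.
  by rewrite /= /mrestr setICl measure0.
move=> x /= h Ux; apply: h => _; rewrite patchE mem_set//.
Qed.

End restricted_measure.

Section kernel_adjoint.
Context d (T : measurableType d) (R : realType).
Variable mu : {sigma_finite_measure set T -> \bar R}.
Variables (U B : set T) (mU : measurable U) (mB : measurable B).
Hypothesis BU : B `<=` U.
Hypothesis Boo : (mu B < +oo)%E.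
Local Notation nu := (mrestr mu mU : {measure set T -> \bar R}).
Variable K : T -> T -> R.
Hypothesis mK : measurable_fun (U `*` U) (fun ts => K ts.1 ts.2).
Local Notation dot := (L2dot nu).

(** The kernel is cut off to [B] times [U] and extended by 0, so that Fubini's theorem can be used
    on the whole product. The first variable is the one at which [KO f] is evaluated. *)
Let K' (z : T * T) : R := ((fun z => K z.1 z.2) \_ (B `*` U)) z.

Let K'E s t : K' (s, t) = \1_B s * (\1_U t * K s t).
Proof.
rewrite /K' patchE in_setX /= !indicE; case: (s \in B); case: (t \in U);
  by rewrite ?mul1r ?mul0r ?mulr0.
Qed.

Let mK' : measurable_fun setT K'.
Proof.
apply/(measurable_restrictT (fun z => K z.1 z.2) (measurableX mB mU)).
by apply: measurable_funS mK; [exact: measurableX|move=> z /= [/BU]].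
Qed.

Let mK'2 t : measurable_fun setT (fun s => K' (s, t)).
Proof. by apply: (measurableT_comp mK'); exact: measurable_pair2. Qed.

(** For [t] in [U] this is the integral of |K(s, t)| over [s] in [B]; its size decides where
    Fubini's theorem applies. *)
Let h t := (\int[mu]_s `|K' (s, t)|%:E)%E.

Let mh : measurable_fun setT h.
Proof.
apply: (measurable_fun_fubini_tonelli_G (fun z => `|K' z|%:E)%E) => //.
by apply/measurable_EFinP; exact: measurableT_comp.
Qed.

Let h_ge0 t : (0 <= h t)%E.
Proof. by apply: integral_ge0 => s _; rewrite lee_fin. Qed.

Lemma indic_Lfun2 : \1_B \in Lfun nu 2%:E.
Proof.
apply/Lfun2P; split; first exact: measurable_indic.
have -> : (\int[nu]_x (\1_B x ^+ 2)%:E = \int[nu]_x (\1_B x)%:E)%E.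
  apply: eq_integral => x _; rewrite indicE.
  by case: (_ \in _); rewrite ?expr1n ?expr0n.
rewrite integral_indic// setIT /= /mrestr.
by rewrite (le_lt_trans _ Boo)// le_measure ?inE//; exact: measurableI.
Qed.

Variable KO : L2 nu -> L2 nu.
Hypothesis KO_bounded : bounded_operator KO.
Hypothesis KO_kernel : forall f : L2 nu, {ae nu, forall t,
  mu.-integrable U (fun s => (K t s * f s)%:E) /\
  KO f t = \int[mu]_(s in U) (K t s * f s)}.
Hypothesis K_integrable : {ae nu, forall t,
  mu.-integrable B (fun s => (K s t)%:E)}.
Variable k : R.
Let g : T -> R := (fun t => k * \int[mu]_(s in B) K s t) \_ U.
Hypothesis g2 : g \in Lfun nu 2%:E.

(** By Tonelli the hypothesis makes K'(s, t) f(t) integrable on the product. Integrating over [t]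
    first produces [KO f] on [B]; integrating over [s] first produces, up to the factor [k], the
    product of [g] and [f]. *)
Let dot_indic_fubini (f : L2 nu) :
  (\int[mu]_t (h t * `|f t|%:E) < +oo)%E ->
  k * dot \1_B (KO f) = dot g f.
Proof.
move=> hf; pose F (z : T * T) : \bar R := (K' z * f z.2)%:E.
have mf : measurable_fun setT f by exact: measurable_funP.
have mF : measurable_fun setT F.
  apply/measurable_EFinP/measurable_funM => //.
  exact: measurableT_comp.
have iF : (mu \x mu)%E.-integrable setT F.
  apply/integrable21ltyP => //; apply: le_lt_trans hf.
  apply: ge0_le_integral => //.
  - by move=> t _; apply: integral_ge0.
  - apply: (measurable_fun_fubini_tonelli_G (abse \o F)) => //.
      exact: measurableT_comp.
    by move=> z; exact: abse_ge0.
  - apply: emeasurable_funM => //; apply/measurable_EFinP.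
    exact: measurableT_comp.
  - move=> t _; rewrite /F /=; under eq_integral do rewrite normrM EFinM.
    rewrite ge0_integralZr//.
    by apply/measurable_EFinP; apply: measurableT_comp => //; exact: mK'2.
have f2 : (f : T -> R) \in Lfun nu 2%:E by exact: LfunP.
have Kf2 : (KO f : T -> R) \in Lfun nu 2%:E by exact: LfunP.
have mA := measurable_int _ (integrable_fubini_F iF).
have mC : measurable_fun setT (fun t => \int[mu]_s F (s, t))%E.
  exact: (measurable_fubini_G iF).
have iC : mu.-integrable setT (fun t => \int[mu]_s F (s, t))%E.
  apply/integrableP; split => //.
  have := iF; rewrite integrable21ltyP// => /(le_lt_trans _); apply.
  apply: ge0_le_integral => //.
  - exact: measurableT_comp.
  - apply: (measurable_fun_fubini_tonelli_G (abse \o F)) => //.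
      exact: measurableT_comp.
    by move=> z; exact: abse_ge0.
  - move=> t _; apply: le_abse_integral => //.
    by apply: (measurableT_comp mF); exact: measurable_pair2.
have eA : (dot \1_B (KO f))%:E = (\int[mu]_s \int[mu]_t F (s, t))%E.
  have m1 := measurable_int _ (Lfun2_integrableM indic_Lfun2 Kf2).
  rewrite (EFin_L2dot indic_Lfun2)// integral_mrestr// integral_mkcond.
  apply: ae_eq_integral => //.
    by apply/(measurable_restrictT _ mU); exact: (measurable_funTS m1).
  apply: filterS (ae_mrestr (KO_kernel f)) => s hs _; rewrite patchE.
  have [sB|sB] := boolP (s \in B); last first.
    rewrite (_ : (\int[mu]_t _)%E = 0%E).
      by case: ifP => // _; rewrite indicE (negbTE sB) mul0r.
    by apply: integral0_eq => t _; rewrite /F K'E indicE (negbTE sB) !mul0r.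
  have Us : U s by apply: BU; exact: set_mem.
  have [iKs ->] := hs Us; rewrite mem_set// indicE sB mul1r.
  rewrite /Rintegral fineK; last exact: integrable_fin_num.
  rewrite integral_mkcond; apply: eq_integral => t _.
  rewrite patchE /F K'E !indicE sB mul1r.
  by case: ifP => _; rewrite ?mul1r// !mul0r.
have eC : (dot g f)%:E = (k%:E * \int[mu]_t \int[mu]_s F (s, t))%E.
  have m1 := measurable_int _ (Lfun2_integrableM g2 f2).
  rewrite EFin_L2dot// integral_mrestr// integral_mkcond.
  rewrite -integralZl//.
  apply: ae_eq_integral => //.
  - by apply/(measurable_restrictT _ mU); exact: (measurable_funTS m1).
  - by apply: measurable_funeM.
  apply: filterS (ae_mrestr K_integrable) => t ht _; rewrite patchE.
  have [tU|tU] := boolP (t \in U); last first.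
    rewrite (_ : (\int[mu]_s _)%E = 0%E) ?mule0//.
    apply: integral0_eq => s _.
    by rewrite /F K'E !indicE (negbTE tU) !mul0r mulr0 mul0r.
  have iKt := ht (set_mem tU).
  rewrite /g patchE tU /Rintegral EFinM EFinM fineK; last exact: integrable_fin_num.
  rewrite -muleA -integralZr// integral_mkcond; congr (_ * _)%E.
  apply: eq_integral => s _; rewrite patchE /F K'E !indicE tU.
  by case: ifP => _; rewrite ?mul1r// !mul0r.
apply: EFin_inj; rewrite EFinM eA eC; congr (_ * _)%E.
exact: Fubini.
Qed.

(* Off the sets E n the integrand need not be jointly integrable; the identity
   extends from f \1_(E n) to f by continuity of both sides in L2. *)
Lemma dot_indic_kernel (f : L2 nu) : k * dot \1_B (KO f) = dot g f.
Proof.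
have f2 : (f : T -> R) \in Lfun nu 2%:E by exact: LfunP.
have mf := Lfun2_measurable f2.
have /sigma_finiteP[F [TF ndF Foo]] := sigma_finiteT mu.
pose E n := F n `&` [set t | (h t <= n%:R%:E)%E].
have mE n : measurable (E n).
  apply: measurableI; first by have [] := Foo n.
  by rewrite -[X in measurable X]setTI; exact: emeasurable_fun_infty_c.
have indic1 n t : `|\1_(E n) t| <= 1 :> R.
  by rewrite indicE; case: (_ \in _); rewrite ?normr1 ?normr0.
have fn2 n : (fun t => \1_(E n) t * f t) \in Lfun nu 2%:E.
  by apply: Lfun2_bounded_mul => //; exact: measurable_indic.
pose fn n : L2 nu := Lfun_Sub (lee1n 2) (fn2 n).
have fnE n : k * dot \1_B (KO (fn n)) = dot g (fn n).
  apply: dot_indic_fubini.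
  (* On [E n], [h] is at most [n] and |f| <= 1 + f^2, so [b] dominates the integrand; it is
     integrable over [U] because [F n] has finite measure and [f] is square integrable. *)
  pose b t : \bar R := (n%:R%:E * ((\1_(F n) t)%:E + (f t ^+ 2)%:E))%E.
  have mFn : measurable (F n) by have [] := Foo n.
  have m1F : measurable_fun setT (fun t => (\1_(F n) t : R)%:E).
    exact/measurable_EFinP/measurable_indic.
  have mf2 : measurable_fun setT (fun t => (f t ^+ 2)%:E).
    exact/measurable_EFinP/measurable_funX.
  have mb : measurable_fun setT b.
    by apply: measurable_funeM; exact: emeasurable_funD.
  apply: (@le_lt_trans _ _ (\int[mu]_(t in U) b t)%E).
    rewrite [leRHS]integral_mkcond; apply: ge0_le_integral => //.
    - by move=> t _; rewrite mule_ge0// lee_fin.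
    - apply: emeasurable_funM => //; apply/measurable_EFinP.
      by apply: measurableT_comp => //; exact: Lfun2_measurable (fn2 n).
    - by apply/(measurable_restrictT _ mU); exact: measurable_funTS.
    - move=> t _; rewrite patchE; case: ifPn => tU; last first.
        rewrite (_ : h t = 0%E) ?mul0e//; apply: integral0_eq => s _.
        by rewrite K'E !indicE (negbTE tU) mul0r mulr0 normr0.
      rewrite /b /= !indicE; have [tE|tE] := boolP (t \in E n); last first.
        rewrite mul0r normr0 mule0 -EFinD -EFinM lee_fin mulr_ge0//.
        by rewrite addr_ge0 ?sqr_ge0.
      have [Ft ht] := set_mem tE.
      rewrite mem_set//= mul1r; apply: lee_pmul; [exact: h_ge0|by rewrite lee_fin|exact: ht|].
      rewrite -EFinD lee_fin -real_normK ?num_real//.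
      have := normr_ge0 (f t); set y := `|f t| => y0; nra.
  rewrite ge0_integralZl//; last 2 first.
  - by apply: measurable_funTS; exact: emeasurable_funD.
  - by move=> t _; rewrite -EFinD lee_fin addr_ge0 ?sqr_ge0.
  rewrite ge0_integralD//; last 3 first.
  - exact: measurable_funTS.
  - by move=> t _; rewrite lee_fin sqr_ge0.
  - exact: measurable_funTS.
  rewrite integral_indic// -(integral_mrestr mu mU)//.
  have [_ f2oo] := (Lfun2P _ _).1 f2.
  rewrite lte_mul_pinfty// ?lee_fin// lte_add_pinfty//.
  rewrite (le_lt_trans _ (Foo n).2)// le_measure ?inE//.
  exact: measurableI.
(* The remainder of [f] off [E n], written in the form [a *: f + g] in which [bounded_operator]
   states linearity. *)
pose w n : L2 nu := (-1) *: fn n + f.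
have wE n t : w n t = f t - fn n t.
  have -> : w n t = -1 * fn n t + f t by [].
  by rewrite addrC mulN1r.
have w2 n : (w n : T -> R) \in Lfun nu 2%:E by exact: LfunP.
have Kf2 (u : L2 nu) : (KO u : T -> R) \in Lfun nu 2%:E by exact: LfunP.
have [KO_linear [C KO_le]] := KO_bounded.
have finN (u : T -> R) : u \in Lfun nu 2%:E ->
    'N[nu]_2%:E[EFin \o u]%E \is a fin_num.
  move=> u2; rewrite ge0_fin_numE ?Lnorm_ge0//.
  by move: u2; rewrite inE => /andP[_ /[!inE]].
pose N u := fine ('N[nu]_2%:E[EFin \o u])%E.
have NE u : u \in Lfun nu 2%:E -> 'N[nu]_2%:E[EFin \o u]%E = (N u)%:E.
  by move=> u2; rewrite fineK// finN.
(* The defect of the identity at [f]. It vanishes at [fn n], so by linearity it equals the defect at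
   [w n], which Cauchy-Schwarz and the boundedness of [KO] bound by [M] times the norm of [w n]. *)
pose a := k * dot \1_B (KO f) - dot g f.
pose M := `|k| * (N \1_B * C) + N g.
have a_le n : `|a| <= M * N (w n).
  have d1 : dot \1_B (KO f) - dot \1_B (KO (fn n)) = dot \1_B (KO (w n)).
    rewrite -L2dotBr ?indic_Lfun2//; apply: L2dot_ae_eq => //.
    - exact: indic_Lfun2.
    - exact: Lfun2B.
    - by apply: filterS (KO_linear (-1) (fn n) f) => x ->; rewrite addrC mulN1r.
  have d2 : dot g f - dot g (fn n) = dot g (w n).
    rewrite -L2dotBr//; last exact: LfunP.
    by congr (L2dot _ _ _); apply/funext => t; rewrite wE.
  have -> : a = k * dot \1_B (KO (w n)) - dot g (w n).
    by rewrite -d1 -d2 mulrBr fnE /a; ring.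
  rewrite (le_trans (ler_normB _ _))// /M mulrDl lerD//.
    rewrite normrM -mulrA ler_wpM2l// -mulrA -lee_fin.
    rewrite (le_trans (L2dot_CauchySchwarz indic_Lfun2 (Kf2 (w n))))//.
    rewrite EFinM EFinM (NE \1_B) ?indic_Lfun2//.
    rewrite lee_wpmul2l ?lee_fin ?fine_ge0 ?Lnorm_ge0//.
    by rewrite -NE.
  by rewrite -lee_fin EFinM -!NE//; exact: L2dot_CauchySchwarz.
(* Dominated convergence with bound f^2: almost every [t] has [h t] finite, hence lies in [E n] for
   all large [n], and then [w n t] is 0. *)
have w_cvg0 : (\int[nu]_x (w n x ^+ 2)%:E)%E @[n --> \oo] --> 0%E.
  have := @dominated_convergence _ _ _ nu setT measurableT
    (fun n x => (w n x ^+ 2)%:E) (cst 0%E) (fun x => (f x ^+ 2)%:E).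
  rewrite integral0; case => //.
  - by move=> n; apply/measurable_EFinP/measurable_funX; exact: Lfun2_measurable.
  - apply: filterS K_integrable => t iKt _.
    have htoo : (h t < +oo)%E.
      have /integrableP[_] := iKt; apply: le_lt_trans.
      rewrite [leRHS]integral_mkcond; apply: ge0_le_integral => //.
      + by apply/measurable_EFinP; apply: measurableT_comp => //; exact: mK'2.
      + apply/(measurable_restrictT _ mB).
        exact: measurableT_comp (@abse_measurable R setT) (measurable_int _ iKt).
      + move=> s _; rewrite patchE K'E !indicE.
        case: ifP => _; last by rewrite mul0r normr0.
        rewrite mul1r abse_EFin lee_fin; case: (t \in U); first by rewrite mul1r.
        by rewrite mul0r normr0.
    have [n0 _ Ft] : (\bigcup_n F n) t by rewrite -TF.
    have [n1 _ hn1] := nbhs_infty_ger (fine (h t)).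
    apply: cvg_near_cst; exists (maxn n0 n1) => // n nn.
    have /andP[n0n n1n] : (n0 <= n)%N && (n1 <= n)%N by rewrite -geq_max.
    have Ent : E n t.
      split; first by move: t Ft {iKt htoo hn1}; exact/subsetPset/ndF.
      by rewrite /= -(fineK (x := h t)) ?ge0_fin_numE// lee_fin; exact: hn1.
    by rewrite wE /= indicE mem_set// mul1r subrr expr0n.
  - exact: Lfun2_integrable_sqr.
  - apply: nearW => t n _; rewrite gee0_abs ?lee_fin ?sqr_ge0// wE /= indicE.
    case: (t \in E n); first by rewrite mul1r subrr expr0n sqr_ge0.
    by rewrite mul0r subr0.
have a0 : a ^+ 2 <= 0.
  rewrite -lee_fin -[leRHS](mule0 (M ^+ 2)%:E).
  have c0 : ((M ^+ 2)%:E * \int[nu]_x (w n x ^+ 2)%:E)%E @[n --> \oo] -->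
      ((M ^+ 2)%:E * 0)%E by apply: cvgeZl.
  rewrite -(cvg_lim _ c0)//; apply: lime_ge.
    by apply/cvg_ex; eexists; exact: c0.
  apply: nearW => n; rewrite -Lnorm2_sqr NE// -!EFinM lee_fin.
  rewrite -expr2 -exprMn -real_normK ?num_real// lerXn2r ?nnegrE//.
  exact: le_trans (a_le n).
apply/eqP; rewrite -subr_eq0 -sqrf_eq0 eq_le sqr_ge0 andbT.
exact: a0.
Qed.

End kernel_adjoint.

(** * Euclidean balls and conclusion *)

Section euclidean_ball.
Context (R : realType) (m : nat).
Implicit Types x : 'rV[R]_m.

Lemma measurable_coord (i : 'I_m) : measurable_fun setT (fun y : 'rV[R]_m => y ord0 i).
Proof.
apply: (measurability _ (RGenOpens.measurableE R)).
move=> _ [_ [a [b ->]] <-]; rewrite setTI; apply: open_measurable_rV.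
apply: open_comp => [v _|]; last exact: interval_open.
exact: coord_continuous.
Qed.

Lemma measurable_eball x r : measurable (eball x r).
Proof.
have mS : measurable_fun setT (fun y : 'rV[R]_m =>
    Num.sqrt (\sum_(i < m) (y ord0 i - x ord0 i) ^+ 2)).
  apply: measurableT_comp.
    by apply: continuous_measurable_fun; exact: sqrt_continuous.
  apply: measurable_sum => i; apply: measurable_funX; apply: measurable_funB => //.
  exact: measurable_coord.
rewrite -[X in measurable X]setTI.
have := mS measurableT _ (measurable_itv `]-oo, r[).
by congr (measurable (_ `&` _)); apply/seteqP; split => y; rewrite /= in_itv.
Qed.

Lemma eball_coord x r y i : eball x r y -> `|y ord0 i - x ord0 i| < r.
Proof.
apply: le_lt_trans; rewrite -sqrtr_sqr ler_sqrt; last first.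
  by apply: sumr_ge0 => j _; exact: sqr_ge0.
by rewrite (bigD1 i)//= lerDl sumr_ge0// => j _; exact: sqr_ge0.
Qed.

Lemma sub_eball_ball x r : eball x r `<=` ball x r.
Proof.
(* The ball of row vectors carries the positivity of its radius as a separate conjunct. *)
move=> y xy; split; first by rewrite (le_lt_trans _ xy)// sqrtr_ge0.
by move=> i j; rewrite ord1 /ball/= distrC; exact: eball_coord.
Qed.

(** The ball lies in a cube, whose measure is a finite product of lengths. *)
Lemma lebesgue_rV_eball_lty x r : (lebesgue_rV (eball x r) < +oo)%E.
Proof.
have [r0|r0] := leP r 0.
  rewrite (_ : eball x r = set0) ?measure0//; apply/seteqP; split => // y.
  by rewrite /eball/= ltNge (le_trans r0)// sqrtr_ge0.
pose A i : set R := ball (x ord0 i) r.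
have mA i : measurable (A i) by exact: measurable_ball.
apply: (@le_lt_trans _ _
  (lebesgue_rV [set v : 'rV[R]_m | forall i, A i (v ord0 i)])).
  apply: le_measure; rewrite ?inE.
  - exact: measurable_eball.
  - rewrite (_ : [set v | _] =
        \bigcap_(i in [set: 'I_m]) ((fun v : 'rV[R]_m => v ord0 i) @^-1` A i)).
      apply: fin_bigcap_measurable => // i _; rewrite -[X in measurable X]setTI.
      exact: measurable_coord.
    by apply/seteqP; split => v h i; [move=> _; exact: h|exact: (h i I)].
  - by move=> y xy i; rewrite /A /ball/= distrC; exact: eball_coord.
rewrite lebesgue_rV_box//.
under eq_bigr do rewrite /A lebesgue_measure_ball ?ltW//.
by rewrite prodEFin ltry.
Qed.

Lemma near_eball_subset x (U : set 'rV[R]_m) : open U -> U x ->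
  \forall r \near 0^'+, eball x r `<=` U.
Proof.
move=> oU Ux; have /nbhs_ballP[e /= e0 xeU] : nbhs x U by exact: open_nbhs_nbhs.
near=> r; apply: subset_trans (@sub_eball_ball x r) _.
apply: subset_trans xeU; apply: le_ball.
by near: r; apply: nbhs_right_le.
Unshelve. all: by end_near. Qed.

End euclidean_ball.

Lemma ae_eq_integral_sqr d (T : measurableType d) (R : realType)
    (mu : {measure set T -> \bar R}) (f g : T -> R) :
  measurable_fun setT f -> measurable_fun setT g ->
  {ae mu, forall x, f x = g x} ->
  (\int[mu]_x (f x ^+ 2)%:E = \int[mu]_x (g x ^+ 2)%:E)%E.
Proof.
move=> mf mg fg; apply: ae_eq_integral => //.
- exact/measurable_EFinP/measurable_funX.
- exact/measurable_EFinP/measurable_funX.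
- by apply: filterS fg => x + _ => ->.
Qed.

(** Monotonicity of the square root. Two measure spaces appear because random variables under [P]
    are compared with functions on [U]. *)
Lemma Lnorm2_le d (T : measurableType d) d' (T' : measurableType d') (R : realType)
    (mu : {measure set T -> \bar R}) (nu : {measure set T' -> \bar R})
    (f : T -> R) (g : T' -> R) (c : R) : 0 <= c ->
  (\int[mu]_x (f x ^+ 2)%:E <= c%:E * \int[nu]_x (g x ^+ 2)%:E)%E ->
  ('N[mu]_2%:E[EFin \o f] <= (c `^ 2^-1)%:E * 'N[nu]_2%:E[EFin \o g])%E.
Proof.
move=> c0 fg; rewrite !Lnorm2E -poweR_EFin -poweRM ?lee_fin ?integral_sqr_ge0//.
apply: gt0_ler_poweR => //.
- by rewrite in_itv/= integral_sqr_ge0 leey.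
- by rewrite in_itv/= leey andbT mule_ge0 ?lee_fin ?integral_sqr_ge0.
Qed.

Theorem lemma10 (R : realType) (m : nat) (U : set 'rV[R]_m) (oU : open U)
    (K : 'rV[R]_m -> 'rV[R]_m -> R)
    (KO : L2 (lebesgue_on oU) -> L2 (lebesgue_on oU))
    (KO_bounded : bounded_operator KO)
    (KO_kernel : integral_operator_with_kernel K KO)
    (e : nat -> L2 (lebesgue_on oU)) (e_basis : orthonormal_basis e)
    (d : measure_display) (Omega : measurableType d) (P : probability Omega R)
    (X : nat -> {RV P >-> R}) (X_iid : iid_standard_normal X)
    (t0 : 'rV[R]_m) (t0U : U t0)
    (K_integrable : \forall eps \near 0^'+, {ae lebesgue_on oU, forall t,
       (@lebesgue_rV R m).-integrable (eball t0 eps) (fun s => (K s t)%:E)})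
    (K_mean_converges : converges_in_L2 (lebesgue_on oU) 0^'+
       (fun eps => (fun t => ball_mean t0 eps (K^~ t)) \_ U)) :
  locally_continuous P (gaussian_process X e KO) t0.
Proof.
have [X_indep X_normal] := X_iid.
(* The common second moment of the variables serves as the bound in the series estimates. *)
pose c : R := fine (\int[normal_prob (0 : R) 1]_x (x ^+ 2)%:E)%E.
have X2 i : (X i : Omega -> R) \in Lfun P 2%:E by exact: standard_normal_Lfun2.
have X0 i : (\int[P]_w (X i w)%:E = 0)%E by exact: standard_normal_mean0.
have Xc i : (\int[P]_w (X i w ^+ 2)%:E <= c%:E)%E.
  rewrite standard_normal_sqr// fineK// ge0_fin_numE ?normal_sqr_lty//.
  by apply: integral_ge0 => x _; rewrite lee_fin sqr_ge0.
have c0 : 0 <= c := variance_bound_ge0 Xc.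
have [oe _] := e_basis; have [mK kerK] := KO_kernel.
have [G2 [g g2 Gg]] := K_mean_converges.
pose nu := lebesgue_on oU.
pose G eps : 'rV[R]_m -> R := (fun t => ball_mean t0 eps (K^~ t)) \_ U.
pose coef (f : 'rV[R]_m -> R) i := L2dot nu f (e i).
pose Y eps w := gaussian_process X e KO \1_(eball t0 eps) w /
  fine (lebesgue_rV (eball t0 eps)).
have mY eps : measurable_fun setT (Y eps).
  by apply: measurable_funM => //; exact: measurable_random_series.
have coefB f h : f \in Lfun nu 2%:E -> h \in Lfun nu 2%:E ->
    coef (fun x => f x - h x) = fun i => coef f i - coef h i.
  move=> f2 h2; apply/funext => i; rewrite /coef !(L2dotC _ _ (e i)).
  by apply: L2dotBr => //; exact: LfunP.
(* The second-moment bound followed by Bessel's inequality makes the random series a bounded map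
   from L^2(U) to L^2(P). *)
have series_le f : f \in Lfun nu 2%:E ->
    (\int[P]_w (random_series X (coef f) w ^+ 2)%:E <=
      c%:E * \int[nu]_x (f x ^+ 2)%:E)%E.
  move=> f2; have [cf f_le] := Bessel f2 oe.
  apply: le_trans (random_series_sqr_le X_indep X2 X0 Xc cf) _.
  by rewrite EFinM lee_wpmul2l// lee_fin.
have series2 f : f \in Lfun nu 2%:E ->
    random_series X (coef f) \in Lfun P 2%:E.
  move=> f2; apply/Lfun2P; split; first exact: measurable_random_series.
  apply: le_lt_trans (series_le f f2) _; rewrite lte_mul_pinfty// ?lee_fin//.
  by have [] := (Lfun2P _ _).1 f2.
(* Dividing by the volume passes inside the series almost surely, and [dot_indic_kernel] at each
   [e i] identifies the resulting coefficients with those of [G eps]. *)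
have YE : \forall eps \near 0^'+, {ae P, forall w,
    Y eps w = random_series X (coef (G eps)) w}.
  near=> eps.
  have BU : eball t0 eps `<=` U by near: eps; exact: near_eball_subset.
  have iK : {ae nu, forall t,
      (@lebesgue_rV R m).-integrable (eball t0 eps) (fun s => (K s t)%:E)}.
    by near: eps; exact: K_integrable.
  have Ge2 : G eps \in Lfun nu 2%:E by near: eps; exact: G2.
  pose k := (fine (lebesgue_rV (eball t0 eps)))^-1.
  have kE : (fun i => L2dot nu \1_(eball t0 eps) (KO (e i)) * k) = coef (G eps).
    apply/funext => i; rewrite mulrC.
    (* [ball_mean] unfolds to [k] times the integral over the ball, so [G eps] is the function [g]
       of that lemma. *)
    exact: (dot_indic_kernel (measurable_eball t0 eps) BU
      (lebesgue_rV_eball_lty t0 eps) mK KO_bounded kerK iK Ge2).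
  have cG : cvgn (series (fun i =>
      (L2dot nu \1_(eball t0 eps) (KO (e i)) * k) ^+ 2)).
    have -> : (fun i => (L2dot nu \1_(eball t0 eps) (KO (e i)) * k) ^+ 2) =
        fun i => coef (G eps) i ^+ 2 by rewrite -kE.
    by have [] := Bessel Ge2 oe.
  have := ae_random_seriesZ X_indep X2 X0 Xc cG.
  by apply: filterS => w; rewrite kE.
split.
  near=> eps; apply/Lfun2P; split; first exact: mY.
  have Ge2 : G eps \in Lfun nu 2%:E by near: eps; exact: G2.
  rewrite (@ae_eq_integral_sqr _ _ _ P (Y eps) (random_series X (coef (G eps))))//.
  - by have [] := (Lfun2P _ _).1 (series2 _ Ge2).
  - exact: measurable_random_series.
  - by near: eps.
exists (random_series X (coef g)); first exact: series2.
(* Almost surely the difference is the random series of [G eps - g], so its norm is at most the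
   square root of [c] times the L^2(U) distance from [G eps] to [g]. *)
apply: (@squeeze_cvge _ _ _ _ (cst 0%E) _
  (fun eps => (c `^ 2^-1)%:E * 'N[nu]_2%:E[EFin \o (G eps \- g)%R])%E).
- near=> eps; rewrite Lnorm_ge0/=; apply: Lnorm2_le => //.
  have Ge2 : G eps \in Lfun nu 2%:E by near: eps; exact: G2.
  have Gg2 := Lfun2B Ge2 g2.
  apply: le_trans (series_le _ Gg2).
  rewrite (@ae_eq_integral_sqr _ _ _ P (Y eps \- random_series X (coef g))
    (random_series X (coef (fun x => G eps x - g x))))//.
  - by apply: measurable_funB => //; exact: measurable_random_series.
  - exact: measurable_random_series.
  have YEe : {ae P, forall w, Y eps w = random_series X (coef (G eps)) w}.
    by near: eps.
  have [cG _] := Bessel Ge2 oe; have [cg _] := Bessel g2 oe.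
  have GB := ae_random_seriesB X_indep X2 X0 Xc cG cg.
  apply: filterS2 YEe GB => w /= -> GB; rewrite -GB coefB//.
- exact: cvg_cst.
- rewrite -[X in _ --> X](mule0 (c `^ 2^-1)%:E).
  exact: cvgeZl.
Unshelve. all: by end_near. Qed.
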